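(* Let $p(\cdot)\in\mathcal{P}_{\gamma_{d}}^{\infty}(\mathbb{R}^{d})\cap LH_{0}(\mathbb{R}^{d})$ and $q_{1}(\cdot),q_{2}(\cdot)\in\mathcal{P}_{0,\infty}$. If $\alpha_1>\alpha_2>0$ and $q_1(t)>q_2(t)$ for a.e. $t>0$, then $F_{p(\cdot),q_1(\cdot)}^{\alpha_{1}}(\gamma_d)\subset F_{p(\cdot),q_2(\cdot)}^{\alpha_{2}}(\gamma_d)$.
   Context: Measures: $\gamma_d(dx)=\pi^{-d/2}e^{-|x|^2}dx$ on $\mathbb{R}^d$, and $\mu(dt)=dt/t$ on $\mathbb{R}^+=(0,\infty)$. Variable Lebesgue norm: for a measure $\nu$ on $\Omega$ and a measurable finite-valued exponent $p(\cdot):\Omega\to[1,\infty)$, $\|f\|_{p(\cdot),\nu}=\inf\{\lambda>0:\int_\Omega |f(x)/\lambda|^{p(x)}\,\nu(dx)\le 1\}$, and $L^{p(\cdot)}(\Omega,\nu)$ is the set of measurable $f$ with $\|f\|_{p(\cdot),\nu}<\infty$. $L^{p(\cdot)}(\gamma_d)=L^{p(\cdot)}(\mathbb{R}^d,\gamma_d)$. Exponent classes: $p(\cdot)\in LH_0(\mathbb{R}^d)$ means $p(\cdot)$ is real-valued and there is $C_1>0$ with $|p(x)-p(y)|\le C_1/\log(e+1/|x-y|)$ for all $x,y\in\mathbb{R}^d$. $p(\cdot)\in\mathcal{P}^\infty_{\gamma_d}(\mathbb{R}^d)$ means $p(\cdot)$ is a measurable exponent with values $\ge1$ and there are $C_{\gamma_d}>0$,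 $p_\infty\ge1$ with $|p(x)-p_\infty|\le C_{\gamma_d}/|x|^2$ for all $x\ne0$. $\mathcal{P}_{0,\infty}$ is the set of measurable $q(\cdot):\mathbb{R}^+\to\mathbb{R}^+$ with $1\le \operatorname{ess\,inf} q\le\operatorname{ess\,sup} q<\infty$, such that the limits $q(0)=\lim_{x\to0}q(x)$ and $q(\infty)=\lim_{x\to\infty}q(x)$ exist and, for some constant $A$, $|q(x)-q(0)|\le A/\ln(1/x)$ for $0<x\le1/2$ and $|q(x)-q(\infty)|\le A/\ln x$ for $x>2$. Semigroups: the Ornstein–Uhlenbeck semigroup is $T_tf(x)=(1-e^{-2t})^{-d/2}\int_{\mathbb{R}^d}\exp\left(-\frac{e^{-2t}(|x|^2+|y|^2)-2e^{-t}\langle x,y\rangle}{1-e^{-2t}}\right)f(y)\,\gamma_d(dy)$, $t>0$; the Poisson–Hermite semigroup is $P_tf(x)=\frac1{\sqrt\pi}\int_0^\infty\frac{e^{-u}}{\sqrt u}T_{t^2/4u}f(x)\,du$, $t>0$. Variable Gaussian Triebel–Lizorkin space: for $\alpha\ge0$ and $k$ the smallest integer greater than $\alpha$, $F^\alpha_{p(\cdot),q(\cdot)}(\gamma_d)$ is the set of $f\in L^{p(\cdot)}(\gamma_d)$ such that $\left\|\left\|t^{k-\alpha}\frac{\partial^kP_tf}{\partial t^k}\right\|_{q(\cdot),\mu}\right\|_{p(\cdot),\gamma_d}<\infty$ (inner norm in the variable $t\in\mathbb{R}^+$, outer norm in $x\in\mathbb{R}^d$). *)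

(* Defs.v *)
From HB Require Import structures.
From mathcomp Require Import all_boot all_order all_algebra.
From mathcomp Require Import all_classical all_reals all_analysis.
From mathcomp Require Import measurable_realfun ess_sup_inf.

Set Implicit Arguments.
Unset Strict Implicit.
Unset Printing Implicit Defensive.

Import Order.TTheory GRing.Theory Num.Theory.
Import numFieldNormedType.Exports.

Local Open Scope classical_set_scope.
Local Open Scope ring_scope.

(* R^d is [d.-tuple R]: the library equips tuples with the product (Borel)
   sigma-algebra. Its Euclidean structure is defined here because the norm that
   the library puts on row vectors is the sup norm. *)
Section euclidean.
Context {R : realType}.

Definition dotp d (x y : d.-tuple R) : R := \sum_(i < d) tnth x i * tnth y i.

Definition enorm d (x : d.-tuple R) : R := Num.sqrt (dotp x x).

Definition edist d (x y : d.-tuple R) : R :=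
  Num.sqrt (\sum_(i < d) (tnth x i - tnth y i) ^+ 2).

Lemma measurable_enorm d : measurable_fun setT (@enorm d).
Proof.
apply: measurableT_comp.
  by apply: continuous_measurable_fun; exact: sqrt_continuous.
apply: measurable_sum => i.
by apply: measurable_funM; exact: measurable_tnth.
Qed.

End euclidean.

Section lebesgue_cons.
Context {R : realType} (n : nat).
Local Open Scope ereal_scope.

Definition tcons (z : R * n.-tuple R) : n.+1.-tuple R :=
  [the n.+1.-tuple R of z.1 :: z.2].

Lemma measurable_tcons : measurable_fun setT tcons.
Proof. exact: measurable_cons. Qed.

Let measurable_preimage_tcons (A : set (n.+1.-tuple R)) :
  measurable A -> measurable (tcons @^-1` A).
Proof. by move=> mA; rewrite -[X in measurable X]setTI; exact: measurable_tcons. Qed.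

Variable m : {sigma_finite_measure set (n.-tuple R) -> \bar R}.

Definition lebesgue_cons : set (n.+1.-tuple R) -> \bar R :=
  pushforward (lebesgue_measure \x m) tcons.

Let lebesgue_cons0 : lebesgue_cons set0 = 0.
Proof. by rewrite /lebesgue_cons /pushforward preimage_set0 measure0. Qed.

Let lebesgue_cons_ge0 A : 0 <= lebesgue_cons A.
Proof. exact: integral_ge0. Qed.

Let lebesgue_cons_sigma_additive : semi_sigma_additive lebesgue_cons.
Proof.
move=> F mF tF mUF; rewrite /lebesgue_cons /pushforward preimage_bigcup.
apply: measure_semi_sigma_additive.
- by move=> k; exact: measurable_preimage_tcons.
- apply/trivIsetP => /= i j _ _ ij; rewrite -preimage_setI.
  by move/trivIsetP : tF => /(_ _ _ _ _ ij) ->//; rewrite preimage_set0.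
- by rewrite -preimage_bigcup; exact: measurable_preimage_tcons.
Qed.

HB.instance Definition _ := isMeasure.Build _ _ _ lebesgue_cons
  lebesgue_cons0 lebesgue_cons_ge0 lebesgue_cons_sigma_additive.

Let lebesgue_cons_sigma_finite : sigma_finite setT lebesgue_cons.
Proof.
pose uncons (t : n.+1.-tuple R) : R * n.-tuple R :=
  (thead t, [tuple of behead t]).
have unconsK : cancel uncons tcons by move=> t; exact/esym/tuple_eta.
have tconsK : cancel tcons uncons.
  by move=> [a t]; rewrite /uncons /= theadE; congr pair; exact/val_inj.
have muncons : measurable_fun setT uncons.
  apply/measurable_fun_pairP; split.
    exact: measurable_tnth.
  exact: measurable_behead.
have /sigma_finiteP[F [TF ndF Foo]] := sigma_finiteT (@lebesgue_measure R).
have /sigma_finiteP[G [TG ndG Goo]] := sigma_finiteT m.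
exists (fun k => uncons @^-1` (F k `*` G k)).
  rewrite -preimage_bigcup (_ : \bigcup_k _ = setT) ?preimage_setT//.
  rewrite -subTset => -[x y] _.
  have [i _ Fix] : (\bigcup_k F k) x by rewrite -TF.
  have [j _ Gjy] : (\bigcup_k G k) y by rewrite -TG.
  exists (maxn i j) => //; split.
  - by move: x Fix; exact/subsetPset/ndF/leq_maxl.
  - by move: y Gjy; exact/subsetPset/ndG/leq_maxr.
move=> k; have [mFk Fkoo] := Foo k; have [mGk Gkoo] := Goo k; split.
  by rewrite -[X in measurable X]setTI; apply: muncons => //; exact: measurableX.
rewrite /lebesgue_cons /pushforward -comp_preimage.
have -> : uncons \o tcons = id by apply/funext => z; exact: tconsK.
rewrite preimage_id.
by rewrite product_measure1E// lte_mul_pinfty// ge0_fin_numE.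
Qed.

HB.instance Definition _ := Measure_isSigmaFinite.Build _ _ _ lebesgue_cons
  lebesgue_cons_sigma_finite.

End lebesgue_cons.

(* Lebesgue measure on R^d, as the d-fold product of the one on R. *)
Fixpoint lebesgue_tuple {R : realType} (d : nat) :
    {sigma_finite_measure set (d.-tuple R) -> \bar R} :=
  match d with
  | 0 => [the {sigma_finite_measure set (0.-tuple R) -> \bar R}
            of dirac [tuple]]
  | n.+1 => [the {sigma_finite_measure set (n.+1.-tuple R) -> \bar R}
            of lebesgue_cons (lebesgue_tuple n)]
  end.

Section gaussian_measure.
Context {R : realType} (d : nat).
Local Open Scope ereal_scope.

Definition gauss_density (x : d.-tuple R) : R :=
  (pi `^ (- (d%:R / 2)) * expR (- enorm x ^+ 2))%R.

Definition gauss_measure (A : set (d.-tuple R)) : \bar R :=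
  \int[lebesgue_tuple d]_(x in A) (gauss_density x)%:E.

Let gauss_density_ge0 x : 0 <= (gauss_density x)%:E.
Proof. by rewrite lee_fin mulr_ge0// ?powR_ge0 ?expR_ge0. Qed.

Let measurable_gauss_density : measurable_fun setT (EFin \o gauss_density).
Proof.
apply/measurable_EFinP; apply: measurable_funM => //.
apply: measurableT_comp => //; apply: measurableT_comp => //.
by apply: measurable_funX; exact: measurable_enorm.
Qed.

Let gauss_measure0 : gauss_measure set0 = 0.
Proof. exact: integral_set0. Qed.

Let gauss_measure_ge0 A : 0 <= gauss_measure A.
Proof. exact: integral_ge0. Qed.

Let gauss_measure_sigma_additive : semi_sigma_additive gauss_measure.
Proof. exact: semi_sigma_additive_nng_induced. Qed.

HB.instance Definition _ := isMeasure.Build _ _ _ gauss_measure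
  gauss_measure0 gauss_measure_ge0 gauss_measure_sigma_additive.

End gaussian_measure.

Section dt_over_t.
Context {R : realType}.
Local Open Scope ereal_scope.

(* The half-line R^+ is the subset `]0, +oo[ of R; the measure dt/t is extended
   by 0 to R. *)
Definition dt_over_t (A : set R) : \bar R :=
  \int[lebesgue_measure]_(t in A `&` `]0%R, +oo[) (t^-1)%:E.

Let dt_over_t0 : dt_over_t set0 = 0.
Proof. by rewrite /dt_over_t set0I integral_set0. Qed.

Let inv_ge0 (A : set R) (t : R) : (A `&` `]0%R, +oo[) t -> 0 <= (t^-1)%:E.
Proof.
by move=> -[_ /=]; rewrite in_itv/= andbT lee_fin invr_ge0 => /ltW.
Qed.

Let dt_over_t_ge0 A : 0 <= dt_over_t A.
Proof. by apply: integral_ge0 => t; exact: inv_ge0. Qed.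

Let dt_over_t_sigma_additive : semi_sigma_additive dt_over_t.
Proof.
move=> F mF tF mUF; rewrite /dt_over_t setI_bigcupl ge0_integral_bigcup//=.
- apply: is_cvg_ereal_nneg_natsum_cond => k _ _.
  by apply: integral_ge0 => t; exact: inv_ge0.
- by move=> k; apply: measurableI; [exact: mF|exact: measurable_itv].
- apply/measurable_EFinP.
  apply: (@measurable_funS _ _ _ _ (`]0%R, +oo[ : set R)).
  - exact: measurable_itv.
  - by move=> t [k _] [].
  apply: open_continuous_measurable_fun; first exact: itv_open_ends_open.
  by move=> t; rewrite inE/= in_itv/= andbT => /lt0r_neq0 /inv_continuous.
- by move=> t [k _]; exact: inv_ge0.
- exact: trivIset_setIr.
Qed.

HB.instance Definition _ := isMeasure.Build _ _ _ dt_over_t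
  dt_over_t0 dt_over_t_ge0 dt_over_t_sigma_additive.

End dt_over_t.

Section variable_lebesgue.
Context d (T : measurableType d) {R : realType}.
Variables (nu : {measure set T -> \bar R}) (D : set T).
Local Open Scope ereal_scope.

(* Luxemburg norm of L^{p(.)}(D, nu), with value +oo when no lambda qualifies.
   [f] is extended-real valued so that norms can be iterated. *)
Definition vLnorm (p : T -> R) (f : T -> \bar R) : \bar R :=
  ereal_inf [set lambda%:E | lambda in [set lambda : R | (0 < lambda)%R /\
    \int[nu]_(x in D) `|f x * (lambda^-1)%:E| `^ p x <= 1]].

(* Functions rather than almost-everywhere classes. *)
Definition vLspace (p : T -> R) : set (T -> R) :=
  [set f | measurable_fun D f /\ vLnorm p (EFin \o f) < +oo].

End variable_lebesgue.

Section exponents.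
Context {R : realType}.

(* When x = y the bound reads 0 <= C1, as 0^-1 = 0. *)
Definition LH0 d (p : d.-tuple R -> R) : Prop :=
  exists2 C1 : R, 0 < C1 &
    forall x y, `|p x - p y| <= C1 / ln (expR 1 + (edist x y)^-1).

Definition P_gauss_infty d (p : d.-tuple R -> R) : Prop :=
  [/\ measurable_fun setT p, (forall x, 1 <= p x) &
    exists C pinf : R, [/\ 0 < C, 1 <= pinf &
      forall x, x != nseq_tuple d 0 -> `|p x - pinf| <= C / enorm x ^+ 2]].

(* Lebesgue measure on R^+, extended by 0 to R. *)
Definition lebesgue_pos : set (measurableTypeR R) -> \bar R :=
  mrestr lebesgue_measure (measurable_itv `](0 : R), +oo[).

HB.instance Definition _ := Measure.on lebesgue_pos.

Definition P_0_infty (q : R -> R) : Prop :=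
  [/\ measurable_fun (`]0, +oo[ : set R) q, (forall t, 0 < t -> 0 < q t),
    (1 <= ess_inf lebesgue_pos (EFin \o q))%E,
    (ess_sup lebesgue_pos (EFin \o q) < +oo)%E &
    exists q0 qoo A : R, [/\ q x @[x --> 0^'+] --> q0, q x @[x --> +oo] --> qoo,
      (forall x, 0 < x <= 2^-1 -> `|q x - q0| <= A / ln x^-1) &
      (forall x, 2 < x -> `|q x - qoo| <= A / ln x)]].

End exponents.

Section semigroups.
Context {R : realType} (d : nat).

Definition ornstein_uhlenbeck (t : R) (f : d.-tuple R -> R)
    (x : d.-tuple R) : R :=
  (1 - expR (- 2 * t)) `^ (- (d%:R / 2)) *
  \int[@gauss_measure R d]_y
    (expR (- ((expR (- 2 * t) * (enorm x ^+ 2 + enorm y ^+ 2)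
               - 2 * expR (- t) * dotp x y) / (1 - expR (- 2 * t)))) * f y).

Definition poisson_hermite (t : R) (f : d.-tuple R -> R)
    (x : d.-tuple R) : R :=
  (Num.sqrt pi)^-1 *
  \int[lebesgue_measure]_(u in `]0, +oo[)
    (expR (- u) / Num.sqrt u * ornstein_uhlenbeck (t ^+ 2 / (4 * u)) f x).

End semigroups.

Section triebel_lizorkin.
Context {R : realType} (d : nat).

(* The smallest integer greater than alpha, for alpha >= 0. *)
Definition order_above (alpha : R) : nat := (Num.truncn alpha).+1.

Lemma order_aboveP (alpha : R) (n : nat) :
  0 <= alpha -> (alpha < n%:R) = (order_above alpha <= n)%N.
Proof. by move=> a0; rewrite -truncn_lt_nat. Qed.

Definition TL_inner (alpha : R) (q : R -> R) (f : d.-tuple R -> R)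
    (x : d.-tuple R) : \bar R :=
  let k := order_above alpha in
  vLnorm dt_over_t `]0, +oo[ q
    (fun t => (t `^ (k%:R - alpha)
               * derive1n k (fun s => poisson_hermite s f x) t)%:E).

Definition triebel_lizorkin (p : d.-tuple R -> R) (q : R -> R) (alpha : R) :
    set (d.-tuple R -> R) :=
  [set f | vLspace (@gauss_measure R d) setT p f /\
           (vLnorm (@gauss_measure R d) setT p (TL_inner alpha q f) < +oo)%E].

End triebel_lizorkin.

(* Main.v *)
Require Import Defs.
From HB Require Import structures.
From mathcomp Require Import all_boot all_order all_algebra.
From mathcomp Require Import all_classical all_reals all_analysis.
From mathcomp Require Import measurable_realfun ess_sup_inf ring lra.

(** Let [D_j t] be the [j]-th derivative of [t |-> P_t f x] and [k_i] the order
    attached to [alpha_i]. The inner norms satisfy, for each [x],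
    [TL_inner alpha2 q2 f x <= C (TL_inner alpha1 q1 f x + G x)], where [G x] is
    an average of [T_s |f| x] over the Ornstein-Uhlenbeck times [s].
    For [t >= 1], [|D_j t| <= C t^(2a - j) G x] with [0 < 2a < alpha2].
    For [t <= 1], integration from [1] recovers [D_k2] from [D_k1] when
    [k2 < k1]; when [k2 = k1], [z^q2 <= 1 + z^q1] suffices because
    [t^(alpha1 - alpha2)] is integrable against [dt/t] near [0].
    The kernel of [G] has bounded mass in each variable and is at most
    [C exp (min (|x|^2, |y|^2))], so [|p x - pinf| <= C / |x|^2] bounds its
    powers of exponent [p x - p y]: a Schur test in variable exponent then
    bounds [G] in [L^p(gamma)], also where [p] takes the value 1. *)

Set Implicit Arguments.
Unset Strict Implicit.
Unset Printing Implicit Defensive.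

Import Order.TTheory GRing.Theory Num.Theory.
Import numFieldNormedType.Exports.

Local Open Scope classical_set_scope.
Local Open Scope ring_scope.

(** On [t >= 1] the first norm cannot control the second: [dt/t] has infinite mass there, and for
    [z <= 1] the inequality [q2 < q1] makes [z^q2] the larger power. The decay has to come from [f]
    itself. After the substitution [u = t^2 v], the Poisson weight [v^(-1/2)] alone would give
    [t^(1 - j)], hence only [t^(1 - alpha2)] once multiplied by [t^(k2 - alpha2)], which does not
    decay if [alpha2 <= 1]. Replacing that weight by [v^(a - 1)] with a small [a > 0] improves this
    to [t^(2a - alpha2)]; the stronger singularity at [v = 0], that is at large Ornstein-Uhlenbeck
    times, is still integrable.

    The second obstacle is measurability: [x |-> TL_inner alpha q f x] is an infimum over a
    continuum and is never shown measurable. The integral of a nonnegative function is a supremum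
    over simple functions below it, which keeps monotonicity and also keeps subadditivity as soon as
    one summand is measurable. The estimates are arranged so that this summand is the one built from
    [G], an integral to which Tonelli applies. *)

Lemma ae_impl d (T : measurableType d) (R : realType)
    (mu : {measure set T -> \bar R}) (P Q : T -> Prop) :
  (forall x, P x -> Q x) -> {ae mu, forall x, P x} -> {ae mu, forall x, Q x}.
Proof.
move=> PQ [N [mN N0 PN]]; exists N; split => // x nQx; apply: PN => /= Px.
exact/nQx/PQ.
Qed.

Lemma ae_and d (T : measurableType d) (R : realType)
    (mu : {measure set T -> \bar R}) (P Q : T -> Prop) :
  {ae mu, forall x, P x} -> {ae mu, forall x, Q x} ->
  {ae mu, forall x, P x /\ Q x}.
Proof.
move=> [N [mN N0 PN]] [M [mM M0 QM]]; exists (N `|` M); split.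
- exact: measurableU.
- by apply: null_set_setU.
- move=> x nPQ; apply: contrapT => /not_orP[nN nM]; apply: nPQ.
  by split; [apply: contrapT => nP; apply: nN; exact: PN
            |apply: contrapT => nQ; apply: nM; exact: QM].
Qed.

(** * Integrals of nonnegative functions that may fail to be measurable *)

Section lower_integral.
Context d (T : measurableType d) {R : realType}.
Variable mu : {measure set T -> \bar R}.
Local Open Scope ereal_scope.
Import HBNNSimple.

Let ge0_addey (x : \bar R) : 0 <= x -> x + +oo = +oo.
Proof. by case: x. Qed.

Lemma ge0_le_integral_nonmeasurable (D : set T) (f g : T -> \bar R) :
  (forall x, D x -> 0 <= f x) -> (forall x, D x -> f x <= g x) ->
  \int[mu]_(x in D) f x <= \int[mu]_(x in D) g x.
Proof.
move=> f0 fg; have g0 x : D x -> 0 <= g x by move=> Dx; exact: le_trans (f0 x Dx) (fg x Dx).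
rewrite !ge0_integralE //= ge_ereal_sup// => _ [h/= hf <-].
apply: ereal_sup_ubound; exists h => //= x; apply: (le_trans (hf x)).
by rewrite /patch; case: ifPn => // /[1!inE] /fg.
Qed.

(** A simple function [s] below [c * f] is [c] times the simple function [c^-1 * s], which lies
    below [f]. *)
Lemma le_integralZl_nonmeasurable (f : T -> \bar R) (c : R) : (0 < c)%R ->
  (forall x, 0 <= f x) ->
  \int[mu]_x (c%:E * f x) <= c%:E * \int[mu]_x f x.
Proof.
move=> c0 f0.
rewrite ge0_integralTE; last by move=> x; rewrite mule_ge0// lee_fin ltW.
apply: ge_ereal_sup => _ [s/= sf <-]; rewrite -integralT_nnsfun.
have -> : \int[mu]_x (s x)%:E = c%:E * \int[mu]_x (c^-1 * s x)%:E.
  rewrite -ge0_integralZl//.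
  - by apply: eq_integral => x _; rewrite -EFinM mulrA mulfV ?mul1r// gt_eqF.
  - by apply/measurable_EFinP; exact: measurable_funM.
  - by move=> x _; rewrite lee_fin mulr_ge0// invr_ge0 ltW.
  - by rewrite lee_fin ltW.
rewrite lee_wpmul2l ?lee_fin ?(ltW c0)//.
apply: ge0_le_integral_nonmeasurable => x _.
  by rewrite lee_fin mulr_ge0// invr_ge0 ltW.
have := sf x; have := f0 x; case: (f x) => [r|_ _|//]; last by rewrite leey.
by rewrite -EFinM !lee_fin => _ sr; rewrite ler_pdivrMl.
Qed.

Let le_integral_addT (f g h : T -> \bar R) :
  (forall x, 0 <= f x) -> (forall x, 0 <= g x) -> (forall x, 0 <= h x) ->
  measurable_fun setT h -> (forall x, f x <= g x + h x) ->
  \int[mu]_x f x <= \int[mu]_x g x + \int[mu]_x h x.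
Proof.
move=> f0 g0 h0 mh fgh.
rewrite ge0_integralTE//; apply: ge_ereal_sup => _ [s/= sf <-].
rewrite -integralT_nnsfun.
pose sh x := maxe ((s x)%:E - h x) 0.
have sh0 x : 0 <= sh x by rewrite /sh le_max lexx orbT.
have msh : measurable_fun setT sh.
  by apply: measurable_maxe => //; apply: emeasurable_funB => //;
     apply/measurable_EFinP.
apply: (@le_trans _ _ (\int[mu]_x (sh x + h x))).
  apply: ge0_le_integral_nonmeasurable => x _; first by rewrite lee_fin.
  rewrite /sh; have := h0 x; case: (h x) => [r|_|//]; last first.
    by rewrite ge0_addey ?leey// le_max lexx orbT.
  move=> r0; rewrite -EFinB -EFin_max -EFinD lee_fin.
  by rewrite -lerBlDr le_max lexx.
rewrite ge0_integralD//; apply: leeD => //.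
apply: ge0_le_integral_nonmeasurable => // x _.
rewrite /sh ge_max g0 andbT; have := sf x; have := fgh x; have := h0 x.
case: (h x) => [r _ fx sx|_ _ _|//]; last by rewrite /= leNye.
by rewrite leeBlDr//; exact: le_trans fx.
Qed.

(* [f] and [g] need not be measurable: a simple function [s <= f] satisfies
   [s <= (s - h)^+ + h] with [(s - h)^+] measurable and below [g]. *)
Lemma ae_le_integral_add (D : set T) (f g h : T -> \bar R) : measurable D ->
  (forall x, D x -> 0 <= f x) -> (forall x, D x -> 0 <= g x) ->
  (forall x, D x -> 0 <= h x) -> measurable_fun D h ->
  {ae mu, forall x, D x -> f x <= g x + h x} ->
  \int[mu]_(x in D) f x <= \int[mu]_(x in D) g x + \int[mu]_(x in D) h x.
Proof.
move=> mD f0 g0 h0 mh [N [mN N0 aeN]].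
(* Adding [+oo] on the null set [N] to the right-hand side costs nothing and makes the inequality
   hold everywhere. *)
have hN0 : \int[mu]_x ((cst +oo : T -> \bar R) \_ N) x = 0.
  by rewrite -integral_mkcond integral_cst// N0 mule0.
rewrite !(integral_mkcond D) -[X in _ <= _ + X]adde0 -[X in _ <= _ + (_ + X)]hN0.
have N0' (x : T) : 0 <= ((cst +oo : T -> \bar R) \_ N) x.
  by apply: erestrict_ge0 => y _; exact: leey.
rewrite -ge0_integralD//; first last.
- by apply/(measurable_restrictT _ mN).1; exact: measurable_cst.
- exact/(measurable_restrictT _ mD).1.
- by move=> x _; exact: erestrict_ge0.
apply: le_integral_addT.
- exact: erestrict_ge0.
- exact: erestrict_ge0.
- by move=> x; rewrite adde_ge0//; exact: erestrict_ge0.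
- apply: emeasurable_funD; first exact/(measurable_restrictT _ mD).1.
  by apply/(measurable_restrictT _ mN).1; exact: measurable_cst.
move=> x; have [xN|xN] := boolP (x \in N).
  rewrite [X in _ + (_ + X)]patchE xN ge0_addey ?erestrict_ge0//.
  by rewrite ge0_addey ?leey ?erestrict_ge0.
rewrite [X in _ + (_ + X)]patchE (negbTE xN) adde0 /patch.
case: ifPn => xD; last by rewrite adde0.
apply: contrapT => fx; move: xN; rewrite notin_setE; apply; apply: aeN => /=.
by move=> /(_ (set_mem xD)).
Qed.

End lower_integral.

(** * Change of variables and of density *)

Section density.
Context d1 d2 (T1 : measurableType d1) (T2 : measurableType d2) {R : realType}.
Variables (mu : {measure set T1 -> \bar R}) (nu : {measure set T2 -> \bar R}).
Variables (phi : T1 -> T2) (g : T1 -> R).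
Local Open Scope ereal_scope.
Import HBNNSimple.
Hypothesis mphi : measurable_fun setT phi.
Hypothesis mg : measurable_fun setT g.
Hypothesis g0 : forall x, (0 <= g x)%R.
Hypothesis nuE : forall A, measurable A ->
  nu A = \int[mu]_(x in phi @^-1` A) (g x)%:E.

Let mEg : measurable_fun setT (EFin \o g).
Proof. exact/measurable_EFinP. Qed.

Let integral_density_nnsfun (h : {nnsfun T2 >-> R}) :
  \int[nu]_x (h x)%:E = \int[mu]_x ((h (phi x))%:E * (g x)%:E).
Proof.
have mi r : measurable_fun setT (fun x => (\1_(h @^-1` [set r]) x)%:E : \bar R).
  by apply/measurable_EFinP; exact: measurable_indic.
have mip r : measurable_fun setT
    (fun x => (\1_(h @^-1` [set r]) (phi x))%:E : \bar R).
  exact: (measurableT_comp (mi r) mphi).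
have hE x : (h x)%:E = \sum_(r \in range h) (r%:E * (\1_(h @^-1` [set r]) x)%:E).
  by rewrite {1}(fimfunE h x) -fsumEFin.
have r0 r : r \in range h -> (0 <= r)%R by move=> /[!inE] -[x _ <-].
have ri0 r x : 0 <= r%:E * (\1_(h @^-1` [set r]) x)%:E :> \bar R.
  by rewrite -EFinM; exact: nnfun_muleindic_ge0.
under eq_integral do rewrite hE.
under [RHS]eq_integral do rewrite hE ge0_mule_fsuml//.
rewrite !ge0_integral_fsum//; last first.
- by move=> r; exact: measurable_funeM.
- by move=> r x _; rewrite mule_ge0// lee_fin.
- by move=> r; apply: emeasurable_funM => //; exact: measurable_funeM.
apply: eq_fsbigr => r rh.
rewrite ge0_integralZl//; last by rewrite lee_fin; exact: r0.
under [RHS]eq_integral do rewrite -muleA.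
rewrite ge0_integralZl//; last 3 first.
- by apply: emeasurable_funM.
- by move=> x _; rewrite mule_ge0// lee_fin.
- by rewrite lee_fin; exact: r0.
rewrite integral_indic// setIT nuE//; congr (_ * _).
rewrite integral_mkcond; apply: eq_integral => x _.
by rewrite epatch_indic muleC /=.
Qed.

(** One statement for four uses: [phi = id] gives the Gaussian measure and [dt/t], [g = 1] the image
    measure under [tcons], and [phi], [g] equal to multiplication by [c] and the constant [c] give
    dilations of the line. *)
Lemma ge0_integral_density (f : T2 -> \bar R) :
  measurable_fun setT f -> (forall x, 0 <= f x) ->
  \int[nu]_x f x = \int[mu]_x (f (phi x) * (g x)%:E).
Proof.
move=> mf f0; pose h := nnsfun_approx measurableT mf.
have hf x : (h n x)%:E @[n --> \oo] --> f x by exact: cvg_nnsfun_approx.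
have ndh x : {homo (fun n => (h n x)%:E) : a b / (a <= b)%N >-> a <= b}.
  by move=> a b ab; rewrite lee_fin; exact/lefP/nd_nnsfun_approx.
transitivity (limn (fun n => \int[nu]_x (h n x)%:E)).
  rewrite -monotone_convergence//.
  - by apply: eq_integral => x _; apply/esym/cvg_lim.
  - by move=> n; apply/measurable_EFinP.
  - by move=> n x _; rewrite lee_fin.
transitivity (limn (fun n => \int[mu]_x ((h n (phi x))%:E * (g x)%:E))).
  by congr (limn _); apply/funext => n; exact: integral_density_nnsfun.
rewrite -monotone_convergence//.
- apply: eq_integral => x _; apply/cvg_lim => //.
  by apply: cvgeZr => //.
- move=> n; apply: emeasurable_funM => //; apply/measurable_EFinP.
  exact: measurableT_comp.
- by move=> n x _; rewrite mule_ge0// lee_fin.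
- by move=> x _ a b ab; rewrite lee_wpmul2r ?lee_fin//; exact: ndh.
Qed.

End density.

Section gauss_measure_theory.
Context {R : realType} (d : nat).
Local Open Scope ereal_scope.

Lemma measurable_gauss_density : measurable_fun setT (@gauss_density R d).
Proof.
apply: measurable_funM => //; apply: measurableT_comp => //.
by apply: measurableT_comp => //; apply: measurable_funX; exact: measurable_enorm.
Qed.

Lemma gauss_density_ge0 (x : d.-tuple R) : (0 <= gauss_density x)%R.
Proof. by rewrite mulr_ge0// ?powR_ge0 ?expR_ge0. Qed.

Lemma ge0_integral_gauss (f : d.-tuple R -> \bar R) :
  measurable_fun setT f -> (forall x, 0 <= f x) ->
  \int[@gauss_measure R d]_x f x =
  \int[lebesgue_tuple d]_x (f x * (gauss_density x)%:E).
Proof.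
move=> mf f0; apply: (@ge0_integral_density _ _ _ _ _ _ _ id) => //.
- exact: measurable_gauss_density.
- exact: gauss_density_ge0.
Qed.

End gauss_measure_theory.

(* Borel sets of [R] carry two displays in the library: Lebesgue measure lives
   on [measurableTypeR R], [dt_over_t] on [R] itself. *)
Lemma measurable_fun_TypeR {R : realType} d (T : measurableType d) (D : set R)
    (f : R -> T) :
  measurable_fun (D : set R) f -> measurable_fun (D : set (measurableTypeR R)) f.
Proof. by move=> mf mD Y mY; exact: (mf mD Y mY). Qed.

Section dt_over_t_theory.
Context {R : realType}.
Local Open Scope ereal_scope.

Lemma measurable_invr_pos : measurable_fun (`]0%R, +oo[ : set R) (@GRing.inv R).
Proof.
apply: open_continuous_measurable_fun; first exact: interval_open.
by move=> t; rewrite inE/= in_itv/= andbT => /lt0r_neq0 /inv_continuous.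
Qed.

Lemma ge0_integral_dt_over_t (f : R -> \bar R) :
  measurable_fun (`]0%R, +oo[ : set R) f -> (forall t, (0 < t)%R -> 0 <= f t) ->
  \int[dt_over_t]_(t in `]0%R, +oo[) f t =
  \int[lebesgue_measure]_(t in `]0%R, +oo[) (f t * (t^-1)%:E).
Proof.
move=> mf f0.
(* The inverse is negative on the negative half-line; its restriction is a nonnegative density on
   the whole line. *)
pose g : R -> R := (@GRing.inv R) \_ `]0%R, +oo[.
have mD : measurable (`]0%R, +oo[ : set R) by exact: measurable_itv.
have mg : measurable_fun setT g.
  exact: ((measurable_restrictT (@GRing.inv R) mD).1 measurable_invr_pos).
rewrite integral_mkcond [RHS]integral_mkcond.
rewrite (@ge0_integral_density _ _ (measurableTypeR R) _ R lebesgue_measure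
  (@dt_over_t R) id g); last 6 first.
- by move=> _ Y mY; rewrite setTI.
- by apply: measurable_fun_TypeR.
- move=> t; rewrite /g /patch; case: ifPn => //.
  rewrite inE/= in_itv/= andbT invr_ge0.
  by move/ltW.
- move=> A mA; rewrite -[LHS]/(\int[lebesgue_measure]_(t in A `&` `]0%R, +oo[) (t^-1)%:E).
  rewrite integral_mkcondr.
  by apply: eq_integral => t _; rewrite /g /patch; case: ifPn.
- exact: ((measurable_restrictT f mD).1 mf).
- by apply: erestrict_ge0 => t /=; rewrite in_itv/= andbT => /f0.
apply: eq_integral => t _; rewrite /g /patch.
by case: ifPn => //; rewrite mul0e.
Qed.

Lemma ae_dt_over_t (P : set R) :
  {ae lebesgue_measure, forall t, P t} -> {ae dt_over_t, forall t, P t}.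
Proof.
move=> [N [mN N0 PN]]; exists N; split => //.
have mI : measurable (N `&` `]0%R, +oo[ : set (measurableTypeR R)).
  exact: measurableI.
change (\int[lebesgue_measure]_(t in N `&` `]0%R, +oo[) (t^-1)%:E = 0 :> \bar R).
apply: null_set_integral => //.
  apply/measurable_EFinP; apply: measurable_funS measurable_invr_pos => //.
by apply: (subset_measure0 mI mN _ N0) => //; exact: subIsetl.
Qed.

End dt_over_t_theory.

Section powR_extra.
Context {R : realType}.

Lemma le0_ler_powR (s t e : R) : 0 < s -> s <= t -> e <= 0 -> t `^ e <= s `^ e.
Proof.
move=> s0 st e0; rewrite -(opprK e) (powRN t) (powRN s) lef_pV2 ?posrE ?powR_gt0//; last lra.
  by apply: ge0_ler_powR => //; rewrite ?nnegrE; lra.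
Qed.

Lemma powR_le1 (s e : R) : 1 <= s -> e <= 0 -> s `^ e <= 1.
Proof. by move=> s1 e0; rewrite -(powRr0 s); exact: ler_powR. Qed.

Lemma measurable_fun_powR d (T : measurableType d) (D : set T) (f p : T -> R) :
  measurable D -> measurable_fun D f -> measurable_fun D p ->
  measurable_fun D (fun x => f x `^ p x).
Proof.
move=> mD mf mp; rewrite /powR.
apply: measurable_fun_if => //; first by apply: measurable_fun_eqr.
  apply: (measurable_funS mD); first exact: subIsetl.
  rewrite (_ : (fun x => _) = (fun x => if p x == 0 then 1 else 0)); last first.
    by apply/funext => x; case: ifP.
  by apply: measurable_fun_if => //; exact: measurable_fun_eqr.
apply: (measurable_funS mD); first exact: subIsetl.
apply: measurableT_comp => //; apply: measurable_funM => //.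
exact: measurableT_comp.
Qed.

End powR_extra.

(** * A Schur test in variable exponent *)

Section variable_exponent_schur.
Context d (T : measurableType d) {R : realType}.
Variable mu : {sigma_finite_measure set T -> \bar R}.

(** To be read with [a = p x] and [b = p y]. Where [f <= tau] the first term suffices. Elsewhere
    [f = f^b f^(1 - b)] with [f^(1 - b) <= s^(1 - b)] for every [1 <= s < f], and
    [s^(1 - b) = s^(1 - a) s^(a - b)] exchanges the exponent at [y] for the one at [x] at the price
    [K]. The choice is [s = tau] if [tau <= m]; otherwise it is [s = m], and then [k <= C * m] with
    [m < tau] gives the third term. *)
Lemma kernel_young_split (k f tau m a b C K : R) :
  0 <= k -> k <= C * m -> 0 <= f -> 1 <= tau -> 1 <= m -> 1 <= a -> 1 <= b ->
  1 <= K -> m `^ (a - b) <= K ->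
  k * f <= k * tau + K * tau `^ (1 - a) * (k * f `^ b) + K * C * tau * f `^ b.
Proof.
move=> k0 kC f0 tau1 m1 a1 b1 K1 mK.
have C0 : 0 <= C by rewrite -(@pmulr_lge0 _ m) ?(le_trans k0)//; lra.
have fb0 : 0 <= f `^ b by exact: powR_ge0.
have ta0 : 0 <= tau `^ (1 - a) by exact: powR_ge0.
have K0 : 0 <= K by lra.
have tau0 : 0 <= tau by lra.
have kf0 : 0 <= k * f `^ b by rewrite mulr_ge0.
have h1 : 0 <= k * tau by rewrite mulr_ge0.
have h2 : 0 <= K * tau `^ (1 - a) * (k * f `^ b) by rewrite !mulr_ge0.
have h3 : 0 <= K * C * tau * f `^ b by rewrite !mulr_ge0.
have fE t : 1 <= t -> t < f -> k * f <= k * f `^ b * t `^ (1 - b).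
  move=> t1 tf; have f1 : 0 < f by lra.
  rewrite -mulrA ler_wpM2l// -[leLHS](powRr1 f0) -{1}(subrKC b 1) powRD; last first.
    by rewrite (gt_eqF f1) implybT.
  by rewrite ler_wpM2l// le0_ler_powR//; lra.
have [ftau|tauf] := leP f tau.
  by apply: (@le_trans _ _ (k * tau)); [exact: ler_wpM2l|lra].
have [taum|mtau] := leP tau m.
  apply: (@le_trans _ _ (K * tau `^ (1 - a) * (k * f `^ b))); last lra.
  apply: (le_trans (fE _ tau1 tauf)); rewrite mulrC ler_wpM2r//.
  rewrite (_ : 1 - b = (a - b) + (1 - a)); last ring.
  rewrite powRD; last by rewrite (gt_eqF (lt_le_trans ltr01 tau1)) implybT.
  (* If [a >= b], compare with [m^(a - b)]; if not, the power is at most 1 because [tau >= 1]. *)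
  rewrite ler_wpM2r//; have [ab|ab] := leP 0 (a - b).
    apply: le_trans mK; by apply: ge0_ler_powR => //; rewrite ?nnegrE; lra.
  by apply: (@le_trans _ _ 1) => //; apply: powR_le1 => //; lra.
apply: (@le_trans _ _ (K * C * tau * f `^ b)); last lra.
apply: (le_trans (fE _ m1 _)); first lra.
rewrite mulrAC ler_wpM2r// (_ : 1 - b = (1 - a) + (a - b)); last ring.
rewrite powRD; last by rewrite (gt_eqF (lt_le_trans ltr01 m1)) implybT.
apply: (@le_trans _ _ (C * m * K)).
  apply: ler_pM => //; first by rewrite mulr_ge0 ?powR_ge0.
  rewrite -[leRHS]mul1r; apply: ler_pM; rewrite ?powR_ge0//.
  by apply: powR_le1 => //; lra.
by rewrite mulrC mulrA ler_wpM2l ?mulr_ge0//; lra.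
Qed.

Local Open Scope ereal_scope.

(** No duality enters, so the exponent 1 is allowed. The modular integrand is bounded at each [x] by
    [1 + A x], where [A] is the kernel applied to [f^p]; this step uses the row bound. Integrating
    [A] by Tonelli uses the column bound. *)
Lemma schur_modular (k : T * T -> \bar R) (m : T -> T -> R) (p f : T -> R)
    (B C K : R) : (0 <= B)%R -> (0 <= C)%R ->
  measurable_fun setT k -> (forall z, 0 <= k z) ->
  (forall x, \int[mu]_y k (x, y) <= B%:E) ->
  (forall y, \int[mu]_x k (x, y) <= B%:E) ->
  (forall x y, k (x, y) <= (C * m x y)%:E) ->
  (forall x y, 1 <= m x y)%R -> (1 <= K)%R ->
  (forall x y, m x y `^ (p x - p y) <= K)%R ->
  measurable_fun setT p -> (forall x, 1 <= p x)%R ->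
  measurable_fun setT f -> (forall x, 0 <= f x)%R ->
  \int[mu]_x (f x `^ p x)%:E <= 1 ->
  \int[mu]_x (((\int[mu]_y (k (x, y) * (f y)%:E)) * ((B + K + K * C)^-1)%:E)
              `^ p x) <= mu setT + B%:E.
Proof.
move=> B0 C0 mk k0 kr kl kC m1 K1 mK mp p1 mf f0 fp.
have mfp : measurable_fun setT (fun y => f y `^ p y)%R.
  exact: measurable_fun_powR.
have fp0 y : 0 <= (f y `^ p y)%:E by rewrite lee_fin powR_ge0.
have mkx x : measurable_fun setT (fun y => k (x, y)) by exact: measurableT_comp.
have mky y : measurable_fun setT (fun x => k (x, y)) by exact: measurableT_comp.
pose A x := \int[mu]_y (k (x, y) * (f y `^ p y)%:E).
have A0 x : 0 <= A x by apply: integral_ge0 => y _; rewrite mule_ge0.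
set D : R := (B + K + K * C)%R.
have D0 : (0 < D)%R.
  by rewrite /D ltr_wpDr ?ltr_wpDl ?mulr_ge0 ?(lt_le_trans _ K1)//; lra.
have pointwise x :
    ((\int[mu]_y (k (x, y) * (f y)%:E)) * (D^-1)%:E) `^ p x <= 1 + A x.
  have := A0 x; case AE : (A x) => [a||]; [|by rewrite addey ?leey|by []].
  rewrite lee_fin => a0.
  (* With [tau^(p x) = 1 + a] one has [tau^(1 - p x) * a <= tau], so the three terms of the
     splitting integrate to at most [tau * B], [tau * K] and [tau * K * C]. Their sum is [tau * D],
     whose quotient by [D] has [p x]-th power [1 + a]. *)
  pose tau := ((1 + a) `^ (p x)^-1)%R.
  have px0 : (0 < p x)%R by rewrite (lt_le_trans _ (p1 x)).
  have tau1 : (1 <= tau)%R.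
    by rewrite -[leLHS](powRr0 (1 + a)%R); apply: ler_powR; rewrite ?lerDl// invr_ge0 ltW.
  have tauE : (tau `^ p x = 1 + a)%R by rewrite -powRrM mulVf ?gt_eqF// powRr1// addr_ge0.
  have tau0 : (0 <= tau)%R by exact: le_trans tau1.
  have K0 : (0 <= K)%R by exact: le_trans K1.
  have t0 : (0 <= tau `^ (1 - p x))%R by exact: powR_ge0.
  have le1 : \int[mu]_y (k (x, y) * (f y)%:E) <= (tau * D)%:E.
    apply: (@le_trans _ _ (\int[mu]_y (tau%:E * k (x, y) +
        ((K * tau `^ (1 - p x))%:E * (k (x, y) * (f y `^ p y)%:E) +
         (K * C * tau)%:E * (f y `^ p y)%:E)))).
      apply: ge0_le_integral_nonmeasurable => y _; first by rewrite mule_ge0 ?lee_fin.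
      have := k0 (x, y); have := kC x y; case: (k (x, y)) => // r.
      rewrite !lee_fin => rC r0; rewrite addrA (mulrC tau).
      by apply: (@kernel_young_split _ _ _ (m x y)).
    have mkf : measurable_fun setT (fun y => k (x, y) * (f y `^ p y)%:E).
      by apply: emeasurable_funM => //; exact/measurable_EFinP.
    have mEfp : measurable_fun setT (fun y => (f y `^ p y)%:E).
      exact/measurable_EFinP.
    have c0 : (0 <= K * tau `^ (1 - p x))%R by rewrite mulr_ge0.
    have d0 : (0 <= K * C * tau)%R by rewrite !mulr_ge0.
    have kf0 y : 0 <= k (x, y) * (f y `^ p y)%:E by rewrite mule_ge0.
    have tk0 y : 0 <= tau%:E * k (x, y) by apply: mule_ge0.
    have h20 y : 0 <= (K * tau `^ (1 - p x))%:E * (k (x, y) * (f y `^ p y)%:E).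
      exact: mule_ge0.
    have h30 y : 0 <= (K * C * tau)%:E * (f y `^ p y)%:E by exact: mule_ge0.
    rewrite ge0_integralD//; [|exact: measurable_funeM| |]; last 2 first.
    - by move=> y _; rewrite adde_ge0.
    - by apply: emeasurable_funD; exact: measurable_funeM.
    rewrite ge0_integralD//; [|exact: measurable_funeM|exact: measurable_funeM].
    rewrite !ge0_integralZl// -/(A x) AE.
    rewrite (_ : tau * D = tau * B + (K * tau `^ (1 - p x) * (1 + a) + K * C * tau))%R; last first.
      rewrite -tauE -mulrA -powRD; last by rewrite (gt_eqF (lt_le_trans ltr01 tau1)) implybT.
      by rewrite subrK powRr1// /D; ring.
    rewrite !EFinD; apply: leeD; first by rewrite EFinM lee_wpmul2l// lee_fin.
    apply: leeD; first by rewrite -EFinM lee_fin ler_wpM2l// lerDr.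
    by rewrite -[leRHS]mule1 lee_wpmul2l// lee_fin.
  have i0 : 0 <= \int[mu]_y (k (x, y) * (f y)%:E).
    by apply: integral_ge0 => y _; rewrite mule_ge0 ?lee_fin.
  rewrite -EFinD -tauE -poweR_EFin; apply: gt0_ler_poweR.
  - exact: ltW.
  - by rewrite in_itv/= leey andbT mule_ge0// lee_fin invr_ge0 ltW.
  - by rewrite in_itv/= leey andbT lee_fin.
  by rewrite lee_pdivrMr.
have mfp2 : measurable_fun setT (fun z : T * T => (f z.2 `^ p z.2)%:E).
  by apply/measurable_EFinP; exact: (measurableT_comp mfp).
have mkfp : measurable_fun setT (fun z => k z * (f z.2 `^ p z.2)%:E).
  exact: emeasurable_funM.
have kfp0 z : 0 <= k z * (f z.2 `^ p z.2)%:E by rewrite mule_ge0.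
have mA : measurable_fun setT A.
  exact: (measurable_fun_fubini_tonelli_F (m2 := mu) _ mkfp kfp0).
apply: (@le_trans _ _ (\int[mu]_x (1 + A x))).
  by apply: ge0_le_integral_nonmeasurable => x _ //; exact: poweR_ge0.
rewrite ge0_integralD// integral_cst// mul1e leeD2l//.
rewrite (fubini_tonelli _ mkfp)//=.
apply: (@le_trans _ _ (\int[mu]_y (B%:E * (f y `^ p y)%:E))).
  apply: ge0_le_integral_nonmeasurable => y _.
    by apply: integral_ge0 => x _; rewrite mule_ge0.
  by rewrite ge0_integralZr// lee_wpmul2r.
rewrite ge0_integralZl ?lee_fin//; last exact/measurable_EFinP.
by rewrite -[leRHS]mule1 lee_wpmul2l// lee_fin.
Qed.

End variable_exponent_schur.

(** * Product integrals on tuples and the Mehler kernel *)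

Section lebesgue_tuple_product.
Context {R : realType}.
Local Open Scope ereal_scope.

Lemma ge0_integral_lebesgue_tupleS n (f : n.+1.-tuple R -> \bar R) :
  measurable_fun setT f -> (forall y, 0 <= f y) ->
  \int[lebesgue_tuple n.+1]_y f y =
  \int[lebesgue_measure]_a \int[lebesgue_tuple n]_y f (tcons (a, y)).
Proof.
move=> mf f0.
have mt : measurable_fun (setT : set (measurableTypeR R * n.-tuple R)) (@tcons R n).
  by move=> _ Y mY; exact: (measurable_tcons measurableT mY).
rewrite (@ge0_integral_density _ _ _ _ _ (lebesgue_measure \x lebesgue_tuple n)
  (lebesgue_tuple n.+1) (@tcons R n) (cst 1%R))//; last first.
  move=> A mA; rewrite [RHS](_ : _ =
    \int[lebesgue_measure \x lebesgue_tuple n]_(x in @tcons R n @^-1` A) cst 1 x)//.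
  rewrite integral_cst ?mul1e//.
  by rewrite -[X in measurable X]setTI; exact: mt.
rewrite fubini_tonelli1/=.
- apply: eq_integral => a _; rewrite /fubini_F.
  by apply: eq_integral => y _; rewrite mule1.
- by under eq_fun do rewrite mule1; exact: measurableT_comp.
- by move=> x; rewrite mule1.
Qed.

(** The factor may vary with the coordinate: in [integral_mehler] it is a normal density whose mean
    is [r * tnth x i]. *)
Lemma integral_lebesgue_tuple_prod d (phi : 'I_d -> R -> R) :
  (forall i, measurable_fun setT (phi i)) -> (forall i a, 0 <= phi i a)%R ->
  (forall i, \int[lebesgue_measure]_a (phi i a)%:E = 1) ->
  \int[lebesgue_tuple d]_y (\prod_(i < d) phi i (tnth y i))%:E = 1.
Proof.
elim: d phi => [|d IH] phi mphi phi0 phi1.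
  rewrite (_ : (fun _ => _) = cst 1); last by apply/funext => y; rewrite big_ord0.
  by rewrite integral_cst// mul1e /= diracT.
rewrite ge0_integral_lebesgue_tupleS; last 2 first.
- apply/measurable_EFinP; apply: measurable_prod => i _.
  exact: (measurableT_comp (mphi i) (measurable_tnth i)).
- by move=> y; rewrite lee_fin prodr_ge0.
rewrite -[RHS](phi1 ord0); apply: eq_integral => a _.
transitivity (\int[lebesgue_tuple d]_y ((phi ord0 a)%:E *
    (\prod_(i < d) phi (lift ord0 i) (tnth y i))%:E)).
  apply: eq_integral => y _; rewrite big_ord_recl EFinM tnth0.
  by congr (_ * _%:E); apply/eq_bigr => i _; rewrite tnthS.
rewrite ge0_integralZl ?lee_fin//.
- by rewrite (IH (fun i => phi (lift ord0 i))) ?mule1.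
- apply/measurable_EFinP; apply: measurable_prod => i _.
  exact: (measurableT_comp (mphi _) (measurable_tnth i)).
- by move=> y _; rewrite lee_fin prodr_ge0.
Qed.

End lebesgue_tuple_product.

(** The inverse is discontinuous at 0. The product below agrees with it everywhere, 0 included since
    [0^-1 = 0], and only involves a power of the nonnegative base [x^2]. *)
Lemma measurable_invr {R : realType} : measurable_fun setT (@GRing.inv R).
Proof.
rewrite (_ : GRing.inv = fun x : R => x * (x ^+ 2) `^ (-1)); last first.
  apply/funext => x; rewrite powR_inv1 ?sqr_ge0//.
  have [->|x0] := eqVneq x 0; first by rewrite invr0 mul0r.
  by field.
apply: measurable_funM => //.
by apply: measurable_fun_powR => //; exact: measurable_funX.
Qed.

Section mehler.
Context {R : realType} (d : nat).
Implicit Types (r : R) (x y : d.-tuple R).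

(** The kernel of [T_t] with respect to the Gaussian measure, for [r = exp (- t)]. In this form it
    is symmetric in [x] and [y]. *)
Definition mehler r x y : R :=
  (1 - r ^+ 2) `^ (- (d%:R / 2)) *
  expR (- ((r ^+ 2 * (enorm x ^+ 2 + enorm y ^+ 2) - 2 * r * dotp x y)
           / (1 - r ^+ 2))).

Lemma mehler_ge0 r x y : 0 <= mehler r x y.
Proof. by rewrite mulr_ge0 ?powR_ge0 ?expR_ge0. Qed.

Lemma dotpC x y : dotp x y = dotp y x.
Proof. by apply: eq_bigr => i _; rewrite mulrC. Qed.

Lemma mehlerC r x y : mehler r x y = mehler r y x.
Proof. by rewrite /mehler dotpC (addrC (enorm x ^+ 2)). Qed.

Lemma enormE x : enorm x ^+ 2 = \sum_(i < d) tnth x i ^+ 2.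
Proof.
rewrite sqr_sqrtr; first by apply: eq_bigr => i _; rewrite expr2.
by apply: sumr_ge0 => i _; rewrite -expr2 sqr_ge0.
Qed.

Lemma sum_sqr_subZ (a b : R) x y :
  \sum_(i < d) (a * tnth x i - b * tnth y i) ^+ 2 =
  a ^+ 2 * enorm x ^+ 2 + b ^+ 2 * enorm y ^+ 2 - 2 * a * b * dotp x y.
Proof.
rewrite !enormE /dotp !mulr_sumr -big_split/= -sumrB; apply: eq_bigr => i _.
by ring.
Qed.

(** Completing the square, the exponent equals [|x|^2 - |x - r y|^2 / (1 - r^2)]. *)
Lemma mehler_le r x y : 0 <= r < 1 ->
  mehler r x y <= (1 - r ^+ 2) `^ (- (d%:R / 2)) * expR (enorm x ^+ 2).
Proof.
move=> /andP[r0 r1]; rewrite ler_wpM2l ?powR_ge0// ler_expR.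
have r2 : 0 < 1 - r ^+ 2 by rewrite subr_gt0 expr_lt1.
rewrite -mulNr ler_pdivrMr//.
have : 0 <= \sum_(i < d) (1 * tnth x i - r * tnth y i) ^+ 2.
  by apply: sumr_ge0 => i _; exact: sqr_ge0.
rewrite sum_sqr_subZ; lra.
Qed.

Lemma mehler_le_min r x y : 0 <= r < 1 ->
  mehler r x y <= (1 - r ^+ 2) `^ (- (d%:R / 2)) *
    expR (Num.min (enorm x ^+ 2) (enorm y ^+ 2)).
Proof.
by move=> r01; rewrite minEle; case: ifPn => _; [|rewrite mehlerC]; exact: mehler_le.
Qed.

(** As a function of [y] this is the density of the normal law with mean [r x] and variance
    [(1 - r^2) / 2] in each coordinate, which is why every Mehler kernel has mass 1. *)
Lemma mehler_gauss_density r x y : 0 <= r < 1 ->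
  mehler r x y * gauss_density y =
  \prod_(i < d) normal_pdf (r * tnth x i) (Num.sqrt ((1 - r ^+ 2) / 2)) (tnth y i).
Proof.
move=> /andP[r0 r1].
have r2 : 0 < 1 - r ^+ 2 by rewrite subr_gt0 expr_lt1.
have s0 : Num.sqrt ((1 - r ^+ 2) / 2) != 0 by rewrite gt_eqF// sqrtr_gt0 divr_gt0.
under eq_bigr do rewrite normal_pdfE//.
rewrite big_split/= prodr_const card_ord /normal_fun.
rewrite -expR_sum /mehler /gauss_density mulrACA -expRD.
have sE : Num.sqrt ((1 - r ^+ 2) / 2) ^+ 2 = (1 - r ^+ 2) / 2.
  by rewrite sqr_sqrtr// divr_ge0// ltW.
congr (_ * expR _).
  have p0 : 0 <= (1 - r ^+ 2) * pi by rewrite mulr_ge0 ?pi_ge0// ltW.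
  rewrite -powRM ?pi_ge0 ?(ltW r2)// /normal_peak sE.
  have -> : (1 - r ^+ 2) / 2 * pi *+ 2 = (1 - r ^+ 2) * pi by rewrite -mulr_natr; field.
  move: (_ * pi) p0 => a a0.
  by rewrite -powR12_sqrt// exprVn -powR_mulrn ?powR_ge0// -powRrM powRN mulrC.
rewrite sE.
under eq_bigr do rewrite mulNr.
rewrite sumrN -mulr_suml.
under eq_bigr => i _ do rewrite -[tnth y i]mul1r.
rewrite sum_sqr_subZ.
have : 1 - r ^+ 2 != 0 by rewrite gt_eqF.
have -> : (1 - r ^+ 2) / 2 *+ 2 = 1 - r ^+ 2 by rewrite -mulr_natr divfK.
by rewrite (dotpC y) => a0; field.
Qed.

Lemma measurable_dotp d' (S : measurableType d') (X Y : S -> d.-tuple R) :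
  measurable_fun setT X -> measurable_fun setT Y ->
  measurable_fun setT (fun s => dotp (X s) (Y s)).
Proof.
move=> mX mY; apply: measurable_sum => i.
by apply: measurable_funM; exact: (measurableT_comp (measurable_tnth i)).
Qed.

Lemma measurable_mehler d' (S : measurableType d') (r : S -> R)
    (X Y : S -> d.-tuple R) : measurable_fun setT r ->
  measurable_fun setT X -> measurable_fun setT Y ->
  measurable_fun setT (fun s => mehler (r s) (X s) (Y s)).
Proof.
move=> mr mX mY.
have mr2 : measurable_fun setT (fun s => 1 - r s ^+ 2).
  by apply: measurable_funB => //; exact: measurable_funX.
have mn (Z : S -> d.-tuple R) : measurable_fun setT Z ->
    measurable_fun setT (fun s => enorm (Z s) ^+ 2).
  move=> mZ; apply: measurable_funX.
  exact: (measurableT_comp (@measurable_enorm R d)).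
apply: measurable_funM; first exact: measurable_fun_powR.
apply: measurableT_comp => //; apply: measurableT_comp => //.
apply: measurable_funM; last exact: (measurableT_comp measurable_invr).
apply: measurable_funB.
  by apply: measurable_funM; [exact: measurable_funX|apply: measurable_funD; exact: mn].
by apply: measurable_funM; [exact: measurable_funM|exact: measurable_dotp].
Qed.

Lemma integral_mehler r x : 0 <= r < 1 ->
  (\int[@gauss_measure R d]_y (mehler r x y)%:E = 1)%E.
Proof.
move=> r01; rewrite ge0_integral_gauss.
- under eq_integral do rewrite -EFinM mehler_gauss_density//.
  apply: (integral_lebesgue_tuple_prod (phi := fun i =>
    normal_pdf (r * tnth x i) (Num.sqrt ((1 - r ^+ 2) / 2)))) => i.
  + by move=> _ Y mY; exact: (@measurable_normal_pdf R _ _ measurableT _ mY).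
  + by move=> a; exact: normal_pdf_ge0.
  + exact: integral_normal_pdf.
- by apply/measurable_EFinP; exact: measurable_mehler.
- by move=> y; rewrite lee_fin mehler_ge0.
Qed.

End mehler.

(** * Power weights on the half-line *)

Section power_integrals.
Context {R : realType}.

Lemma continuous_powR_within (b x y : R) : (0 < x) ->
  {within `[x, y], continuous (fun t : R => t `^ b)}.
Proof.
move=> x0; apply: derivable_within_continuous => t; rewrite in_itv/= => /andP[xt _].
by apply: derivable_powR; rewrite in_itv/= andbT (lt_le_trans x0).
Qed.

Lemma integral_powR (b x y : R) : b != 0 -> (0 < x < y) ->
  (\int[lebesgue_measure]_(t in `[x, y]) (t `^ (b - 1))%:E =
   ((y `^ b - x `^ b) / b)%:E)%E.
Proof.
move=> b0 /andP[x0 xy].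
have dF (t : R) : (0 < t) -> is_derive t (1 : R) (fun s => b^-1 * s `^ b) (t `^ (b - 1)).
  move=> t0; have := is_deriveZ b^-1 (is_derive1_powR b t0).
  by rewrite /GRing.scale/= mulrA mulVf// mul1r.
have cF (t : R) : (0 < t) -> {for t, continuous (fun s => b^-1 * s `^ b)}.
  by move=> t0; apply: differentiable_continuous; apply/derivable1_diffP; case: (dF t t0).
rewrite (@continuous_FTC2 _ _ (fun s => b^-1 * s `^ b))//.
- by rewrite -EFinB -mulrBr mulrC.
- exact: continuous_powR_within.
- split.
  + by move=> t; rewrite in_itv/= => /andP[xt _]; case: (dF t (lt_trans x0 xt)).
  + by apply: cvg_at_right_filter; exact: cF.
  + by apply: cvg_at_left_filter; apply: cF; exact: lt_trans xy.
- move=> t; rewrite in_itv/= => /andP[xt _].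
  by rewrite derive1E; case: (dF t (lt_trans x0 xt)) => _ ->.
Qed.

(** For [a > 0] this is [t^a] below 1 and [t^(- a)] above, so it is integrable against [dt/t] at
    both ends. *)
Definition two_sided_power (a t : R) : R := Num.min (t `^ a) (t `^ (- a)).

Lemma two_sided_power_ge0 a t : (0 <= two_sided_power a t).
Proof. by rewrite /two_sided_power le_min !powR_ge0. Qed.

Lemma measurable_two_sided_power a : measurable_fun setT (two_sided_power a).
Proof. by apply: measurable_minr; exact: measurable_powR. Qed.

Lemma two_sided_powerVE (a t : R) : (0 < t) ->
  (two_sided_power a t * t^-1 = Num.min (t `^ (a - 1)) (t `^ (- a - 1))).
Proof.
move=> t0; have tn0 : t != 0 by rewrite gt_eqF.
rewrite /two_sided_power minr_pMl ?invr_ge0 ?ltW//.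
by rewrite -(powR_inv1 (ltW t0)) -!powRD ?tn0 ?implybT.
Qed.

Lemma integral_two_sided_power (a : R) : (0 < a) ->
  (\int[lebesgue_measure]_(t in `]0%R, +oo[) (two_sided_power a t * t^-1)%:E <=
   (2 / a)%:E)%E.
Proof.
move=> a0.
(* The shift by 2 keeps 1 strictly inside each interval: the integral is split at 1, and each half
   contributes at most [a^-1]. *)
pose F (n : nat) : set R := `[(n.+2%:R)^-1, n.+2%:R]%classic.
have FE : \bigcup_n F n = `]0, +oo[%classic.
  apply/seteqP; split => t /=.
    move=> [n _]; rewrite /F/= !in_itv/= andbT => /andP[+ _].
    exact/lt_le_trans.
  rewrite in_itv/= andbT => t0.
  pose M := Num.max t t^-1; exists (Num.truncn M) => //.
  have Mn : (M < (Num.truncn M).+2%:R).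
    by apply: (lt_trans (truncnS_gt _)); rewrite ltr_nat.
  rewrite /F/= in_itv/=; apply/andP; split.
    rewrite invf_ple ?posrE//; apply: le_trans (ltW Mn).
    by rewrite le_max lexx orbT.
  by apply: le_trans (ltW Mn); rewrite le_max lexx.
pose f (t : R) := (two_sided_power a t * t^-1)%:E : \bar R.
have mf : measurable_fun setT f.
  apply/measurable_EFinP; apply: measurable_funM; last exact: measurable_invr.
  exact: measurable_two_sided_power.
have F0 n t : F n t -> (0 < t).
  by rewrite /F/= in_itv/= => /andP[+ _]; exact/lt_le_trans.
have f0 n t : F n t -> (0 <= f t)%E.
  by move=> /F0 t0; rewrite lee_fin mulr_ge0 ?two_sided_power_ge0// invr_ge0 ltW.
have ndF : nondecreasing_seq F.
  move=> m n mn; apply/subsetPset => t; rewrite /F/= !in_itv/= => /andP[mt tm].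
  rewrite (le_trans _ mt) ?(le_trans tm) ?ler_nat ?ltnS//.
  by rewrite lef_pV2 ?posrE// ler_nat ltnS.
have mF n : measurable (F n : set (measurableTypeR R)) by exact: measurable_itv.
have mFf n : measurable_fun (F n : set (measurableTypeR R)) f.
  by apply: measurable_fun_TypeR; exact: measurable_funS mf.
have := ge0_nondecreasing_set_cvg_integral (mu := lebesgue_measure) ndF mF mFf f0.
rewrite FE => Fcvg; rewrite -(cvg_lim _ Fcvg)//; apply: lime_le.
  by apply/cvg_ex; eexists; exact: Fcvg.
apply: nearW => n; rewrite /F.
have n1 : (1 < n.+2%:R :> R) by rewrite ltr1n.
have n0 : (0 < n.+2%:R :> R) by rewrite ltr0n.
have nV1 : ((n.+2%:R)^-1 < 1 :> R) by rewrite invf_lt1.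
have nV0 : (0 < (n.+2%:R)^-1 :> R) by rewrite invr_gt0.
have fE t : (0 < t) -> f t = (Num.min (t `^ (a - 1)) (t `^ (- a - 1)))%:E.
  by move=> t0; rewrite /f two_sided_powerVE.
rewrite (@itv_bndbnd_setU _ _ _ (BRight 1)); last 2 first.
- by rewrite bnd_simp ltW.
- by rewrite bnd_simp ltW.
have fp t : 0 < t -> (0 <= f t)%E.
  by move=> t0; rewrite lee_fin mulr_ge0 ?two_sided_power_ge0// invr_ge0 ltW.
rewrite ge0_integral_setU//=; last 3 first.
- by apply: measurable_fun_TypeR; exact: measurable_funS mf.
- move=> t; rewrite !in_itv/= => -[/andP[nt _]|/andP[t1 _]].
    by apply: fp; exact: lt_le_trans nt.
  by apply: fp; exact: lt_trans t1.
- apply/disj_setPS => t [] /=; rewrite !in_itv/= => /andP[_ t1] /andP[].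
  by rewrite ltNge t1.
rewrite (_ : 2 / a = a^-1 + a^-1); last by ring.
rewrite EFinD; apply: leeD.
  apply: (@le_trans _ _ (\int[lebesgue_measure]_(t in `[(n.+2%:R)^-1%R, 1%R]) (t `^ (a - 1))%:E))%E.
    apply: ge0_le_integral_nonmeasurable => t /=; rewrite in_itv/= => /andP[nt _].
      by apply: fp; exact: lt_le_trans nt.
    by rewrite fE ?(lt_le_trans nV0)// lee_fin ge_min lexx.
  rewrite integral_powR ?gt_eqF ?nV0// lee_fin powR1 -[leRHS]mul1r.
  by rewrite ler_wpM2r ?invr_ge0 ?(ltW a0)// gerBl powR_ge0.
apply: (@le_trans _ _ (\int[lebesgue_measure]_(t in `[1%R, n.+2%:R]) (t `^ (- a - 1))%:E))%E.
  rewrite (integral_itv_obnd_cbnd (f := f)); last first.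
    by apply: measurable_fun_TypeR; exact: measurable_funS mf.
  apply: ge0_le_integral_nonmeasurable => t /=; rewrite in_itv/= => /andP[nt _].
    by apply: fp; exact: lt_le_trans nt.
  by rewrite fE ?(lt_le_trans ltr01)// lee_fin ge_min lexx orbT.
rewrite integral_powR ?oppr_eq0 ?gt_eqF ?ltr01//. rewrite lee_fin powR1.
rewrite invrN mulrN -mulNr opprB -[leRHS]mul1r.
by rewrite ler_wpM2r ?invr_ge0 ?(ltW a0)// gerBl powR_ge0.
Qed.

End power_integrals.

Section weight.
Context {R : realType}.

(** For [n > 0], [exp (c s)] is the [n]-th power of [exp (c s / n)], which is at least [c s / n];
    hence the constant [(n / c)^n]. *)
Lemma exprn_expRN_bounded (n : nat) (c : R) : 0 < c ->
  exists2 C : R, 0 < C & forall s, 0 <= s -> s ^+ n * expR (- (c * s)) <= C.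
Proof.
move=> c0; case: n => [|n].
  exists 1 => // s s0; rewrite expr0 mul1r -expR0 ler_expR oppr_le0 mulr_ge0//.
  exact: ltW.
have n0 : 0 < n.+1%:R :> R by rewrite ltr0n.
exists ((n.+1%:R / c) ^+ n.+1); first by rewrite exprn_gt0// divr_gt0.
move=> s s0; rewrite expRN ler_pdivrMr ?expR_gt0//.
have -> : expR (c * s) = expR (c * s / n.+1%:R) ^+ n.+1.
  by rewrite -expRM_natl; congr expR; field; rewrite gt_eqF.
have nc0 : 0 <= n.+1%:R / c by rewrite divr_ge0// ltW.
rewrite -exprMn; apply: lerXn2r; rewrite ?nnegrE//.
  by rewrite mulr_ge0// expR_ge0.
apply: (@le_trans _ _ (n.+1%:R / c * (c * s / n.+1%:R))).
  move: (n.+1%:R : R) n0 {nc0} => m m0.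
  by rewrite (_ : m / c * (c * s / m) = s)//; field; rewrite !gt_eqF.
rewrite ler_wpM2l//.
by apply: le_trans (expR_ge1Dx _); rewrite lerDr.
Qed.

(** An unnormalized Gamma density. The value [a = 1/2] is the singularity of the subordination
    formula; the smaller values of [a] serve in the average [G]. *)
Definition weight (c a v : R) : R := v `^ (a - 1) * expR (- (c * v)).

Lemma weight_ge0 c a v : 0 <= weight c a v.
Proof. by rewrite mulr_ge0 ?powR_ge0 ?expR_ge0. Qed.

Lemma measurable_weight c a : measurable_fun setT (weight c a).
Proof.
apply: measurable_funM; first exact: measurable_powR.
by apply: measurableT_comp => //; apply: measurableT_comp => //; exact: measurable_funM.
Qed.

(** The factor [(1 + 2 v)^d] will come from the normalization of the Mehler kernel. Decay like
    [v^(- a - 1)] costs a further [v^(2 a) <= 1 + 2 v], where [2 a <= 1] enters; hence the exponent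
    [d.+1] in the exponential bound. *)
Lemma weight_le (c a : R) (d : nat) : 0 < c -> 0 < a -> 2 * a <= 1 ->
  exists2 C : R, 0 < C & forall v, 0 < v ->
    weight c a v * (1 + 2 * v) ^+ d <= C * (two_sided_power a v * v^-1).
Proof.
move=> c0 a0 a1; have c2 : 0 < c / 2 by lra.
have [C C0 HC] := @exprn_expRN_bounded d.+1 _ c2.
(* The bound is applied at [s = 1 + 2 v] with rate [c / 2], and [exp (- (c / 2) s)] is [exp (- c v)]
   times [exp (- c / 2)]. *)
pose C' := C * expR (c / 2); have C'0 : 0 < C' by rewrite mulr_gt0 ?expR_gt0.
exists C' => // v v0; rewrite two_sided_powerVE//.
have s1 : 1 <= 1 + 2 * v by lra.
have key : (1 + 2 * v) ^+ d.+1 * expR (- (c * v)) <= C'.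
  have := HC (1 + 2 * v) ltac:(lra).
  rewrite (_ : - (c / 2 * (1 + 2 * v)) = - (c * v) - c / 2); last by field.
  by rewrite expRD mulrA (expRN (c / 2)) ler_pdivrMr ?expR_gt0.
rewrite minr_pMr ?(ltW C'0)// le_min; apply/andP; split.
  rewrite (_ : _ * _ = v `^ (a - 1) * ((1 + 2 * v) ^+ d * expR (- (c * v)))); last first.
    by rewrite /weight; ring.
  rewrite [leRHS]mulrC ler_wpM2l ?powR_ge0//.
  apply: le_trans key; rewrite ler_wpM2r ?expR_ge0// exprS ler_peMl//.
  by rewrite exprn_ge0//; lra.
have -> : v `^ (- a - 1) = v `^ (a - 1) * (v `^ (2 * a))^-1.
  rewrite -powRN -powRD; last by rewrite (gt_eqF v0) implybT.
  by congr (_ `^ _); ring.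
rewrite mulrA ler_pdivlMr ?powR_gt0//.
rewrite (_ : weight c a v * _ * _ =
    v `^ (a - 1) * ((1 + 2 * v) ^+ d * v `^ (2 * a) * expR (- (c * v)))); last first.
  by rewrite /weight; ring.
rewrite (mulrC C') ler_wpM2l ?powR_ge0//.
apply: le_trans key; rewrite ler_wpM2r ?expR_ge0//.
rewrite exprSr ler_wpM2l ?exprn_ge0//; first lra.
have [v1|v1] := leP v 1.
  apply: (@le_trans _ _ (1 `^ (2 * a))); last by rewrite powR1.
  by apply: ge0_ler_powR => //; rewrite ?nnegrE; lra.
apply: (@le_trans _ _ v); last lra.
by rewrite -[leRHS](powRr1 (ltW v0)); apply: ler_powR => //; exact: ltW.
Qed.

Lemma integral_weight_lty (c a : R) (d : nat) : 0 < c -> 0 < a -> 2 * a <= 1 ->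
  exists2 C : R, 0 <= C &
    (\int[lebesgue_measure]_(v in `]0%R, +oo[)
       (weight c a v * (1 + 2 * v) ^+ d)%:E <= C%:E)%E.
Proof.
move=> c0 a0 a1; have [C C0 HC] := weight_le d c0 a0 a1.
exists (C * (2 / a)); first by rewrite mulr_ge0 ?divr_ge0 ?(ltW C0) ?(ltW a0).
apply: (@le_trans _ _ (\int[lebesgue_measure]_(v in `]0%R, +oo[)
       (C%:E * (two_sided_power a v * v^-1)%:E)))%E.
  apply: ge0_le_integral_nonmeasurable => v /=; rewrite in_itv/= andbT => v0.
    by rewrite lee_fin mulr_ge0 ?weight_ge0// exprn_ge0//; lra.
  by rewrite -EFinM lee_fin; exact: HC.
rewrite ge0_integralZl//; last 3 first.
- apply: measurable_fun_TypeR; apply/measurable_EFinP.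
  apply: (@measurable_funS _ _ _ _ setT) => //; apply: measurable_funM.
    exact: measurable_two_sided_power.
  exact: measurable_invr.
- move=> v /=; rewrite in_itv/= andbT => v0.
  by rewrite lee_fin mulr_ge0 ?two_sided_power_ge0// invr_ge0 ltW.
- by rewrite lee_fin ltW.
by rewrite EFinM lee_wpmul2l ?lee_fin ?(ltW C0)//; exact: integral_two_sided_power.
Qed.

End weight.

Section gauss_probability.
Context {R : realType} (d : nat).

(** At [r = 0] the Mehler kernel is the constant 1, so its mass is the total mass of the measure. *)
Let gauss_measureT : (@gauss_measure R d setT = 1)%E.
Proof.
have := @integral_mehler R d 0 (nseq_tuple d 0).
rewrite lexx ltr01 => /(_ isT) <-.
rewrite (eq_integral (cst 1%E)); first by rewrite integral_cst// mul1e.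
move=> y _; rewrite /mehler expr0n/= subr0 powR1 mul0r mulr0 mul0r subrr mul0r oppr0.
by rewrite expR0 mulr1.
Qed.

HB.instance Definition _ := Measure_isProbability.Build _ _ _
  (@gauss_measure R d) gauss_measureT.

End gauss_probability.

(** * The kernel of [G] and its boundedness on the variable Lebesgue space *)

Section averaged_mehler.
Context {R : realType} (d : nat).
Implicit Types (x y : d.-tuple R).

(* [ratio v] is [exp (- t)] at the Ornstein-Uhlenbeck time [t = 1 / (4 v)]. *)
Definition ratio (v : R) : R := expR (- (4 * v)^-1).

Lemma ratio_bounds v : 0 < v -> 0 <= ratio v < 1.
Proof.
by move=> v0; rewrite expR_ge0/= -expR0 ltr_expR oppr_lt0 invr_gt0 mulr_gt0.
Qed.

Lemma measurable_ratio : measurable_fun setT ratio.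
Proof.
apply: measurableT_comp => //; apply: measurableT_comp => //.
by apply: (measurableT_comp measurable_invr); exact: measurable_funM.
Qed.

(** From [exp s >= 1 + s] at [s = 1 / (2 v)] follows [1 - exp (- s) >= 1 / (1 + 2 v)]. Passing from
    the power [d / 2] to [d] only serves to have a natural exponent. *)
Lemma mehler_factor_le v : 0 < v ->
  (1 - ratio v ^+ 2) `^ (- (d%:R / 2)) <= (1 + 2 * v) ^+ d.
Proof.
move=> v0; have s0 : 1 <= 1 + 2 * v by lra.
have le1 : (1 + 2 * v)^-1 <= 1 - ratio v ^+ 2.
  rewrite /ratio -expRM_natl mulrN expRN.
  have e0 : 0 < (2 * v)^-1 by rewrite invr_gt0; lra.
  have -> : 2%:R * (4 * v)^-1 = (2 * v)^-1 by field; rewrite gt_eqF.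
  have h := expR_ge1Dx (2 * v)^-1.
  have : (expR (2 * v)^-1)^-1 <= (1 + (2 * v)^-1)^-1.
    by rewrite lef_pV2 ?posrE ?expR_gt0//; lra.
  have -> : (1 + (2 * v)^-1)^-1 = 1 - (1 + 2 * v)^-1.
    by field; rewrite !gt_eqF//; lra.
  by lra.
rewrite powRN -(powR_mulrn _ (le_trans ler01 s0)).
rewrite -[leRHS]invrK lef_pV2 ?posrE ?invr_gt0 ?powR_gt0//; last 2 first.
- by apply: lt_le_trans le1; rewrite invr_gt0; lra.
- by lra.
rewrite -powRN.
apply: (@le_trans _ _ ((1 + 2 * v)^-1 `^ (d%:R / 2))).
  rewrite -(powR_inv1 (le_trans ler01 s0)) -powRrM mulN1r.
  by apply: ler_powR => //; rewrite lerN2 ler_pdivrMr// ler_peMr// ?ler0n// ler1n.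
apply: ge0_ler_powR => //.
- by rewrite nnegrE invr_ge0; lra.
- by rewrite nnegrE; apply: le_trans le1; rewrite invr_ge0; lra.
Qed.

(** The rate [1/4] is what remains of [exp (- t^2 v / 2)] for [t >= 1] when half of that factor is
    spent on a power of [t^2 v]. *)
Definition averaged_mehler (a : R) (z : d.-tuple R * d.-tuple R) : \bar R :=
  (\int[lebesgue_measure]_(v in `]0%R, +oo[)
     (weight 4^-1 a v * mehler (ratio v) z.1 z.2)%:E)%E.

Let q0 : 0 < 4^-1 :> R. Proof. by lra. Qed.

Let integrand (a : R) (z : (d.-tuple R * d.-tuple R) * measurableTypeR R) : \bar R :=
  (((weight 4^-1 a \_ `]0, +oo[) z.2) * mehler (ratio z.2) z.1.1 z.1.2)%:E.

Let mW a : measurable_fun (setT : set R) (weight 4^-1 a \_ `]0, +oo[).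
Proof.
apply: (measurable_restrictT _ _).1 => //.
by apply: measurable_funS (measurable_weight 4^-1 a).
Qed.

Let integrand_ge0 a z : (0 <= integrand a z)%E.
Proof.
by rewrite lee_fin mulr_ge0 ?mehler_ge0// /patch; case: ifPn => // _; exact: weight_ge0.
Qed.

Let mintegrand a : measurable_fun setT (integrand a).
Proof.
apply/measurable_EFinP; apply: measurable_funM.
  by apply: (measurableT_comp (measurable_fun_TypeR (mW a))).
apply: measurable_mehler.
- by apply: (measurableT_comp (measurable_fun_TypeR measurable_ratio)).
- by apply: measurableT_comp.
- by apply: measurableT_comp.
Qed.

Let averaged_mehlerE a z : averaged_mehler a z =
  (\int[lebesgue_measure]_v integrand a (z, v))%E.
Proof.
rewrite /averaged_mehler integral_mkcond; apply: eq_integral => v _.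
by rewrite /integrand /patch/=; case: ifPn => // _; rewrite mul0r.
Qed.

Lemma averaged_mehler_ge0 a z : (0 <= averaged_mehler a z)%E.
Proof. by rewrite averaged_mehlerE; apply: integral_ge0 => v _; exact: integrand_ge0. Qed.

Lemma measurable_averaged_mehler a : measurable_fun setT (averaged_mehler a).
Proof.
rewrite (_ : averaged_mehler a = fubini_F lebesgue_measure (integrand a)).
  exact: measurable_fun_fubini_tonelli_F.
by apply/funext => z; rewrite averaged_mehlerE.
Qed.

Lemma averaged_mehlerC a x y : averaged_mehler a (x, y) = averaged_mehler a (y, x).
Proof. by rewrite /averaged_mehler; under eq_integral do rewrite mehlerC. Qed.

Lemma averaged_mehler_le a : 0 < a -> 2 * a <= 1 ->
  exists2 C : R, 0 <= C & forall x y, (averaged_mehler a (x, y) <=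
    (C * expR (Num.min (enorm x ^+ 2) (enorm y ^+ 2)))%:E)%E.
Proof.
move=> a0 a1; have [C C0 HC] := integral_weight_lty d q0 a0 a1.
exists C => // x y; set m := expR _; have m0 : 0 <= m by exact: expR_ge0.
apply: (@le_trans _ _ (\int[lebesgue_measure]_(v in `]0%R, +oo[)
    (m%:E * (weight 4^-1 a v * (1 + 2 * v) ^+ d)%:E)))%E.
  apply: ge0_le_integral_nonmeasurable => v /=; rewrite in_itv/= andbT => v0.
    by rewrite lee_fin; apply: mulr_ge0; [exact: weight_ge0|exact: mehler_ge0].
  rewrite -EFinM lee_fin [leRHS]mulrCA ler_wpM2l ?weight_ge0//.
  apply: (le_trans (mehler_le_min x y (ratio_bounds v0))).
  by rewrite mulrC ler_wpM2l//; exact: mehler_factor_le.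
rewrite ge0_integralZl//.
- by rewrite mulrC EFinM lee_wpmul2l.
- apply: measurable_fun_TypeR; apply/measurable_EFinP.
  apply: (@measurable_funS _ _ _ _ setT) => //; apply: measurable_funM.
    exact: measurable_weight.
  apply: measurable_funX; apply: measurable_funD => //.
- move=> v /=; rewrite in_itv/= andbT => v0.
  by rewrite lee_fin mulr_ge0 ?weight_ge0// exprn_ge0//; lra.
Qed.

Lemma integral_averaged_mehler a x (f : d.-tuple R -> R) :
  measurable_fun setT f -> (forall y, 0 <= f y) ->
  (\int[@gauss_measure R d]_y (averaged_mehler a (x, y) * (f y)%:E) =
   \int[lebesgue_measure]_(v in `]0%R, +oo[) ((weight 4^-1 a v)%:E *
     \int[@gauss_measure R d]_y (mehler (ratio v) x y * f y)%:E))%E.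
Proof.
move=> mf f0.
pose g (z : d.-tuple R * measurableTypeR R) :=
  (integrand a ((x, z.1), z.2) * (f z.1)%:E)%E.
have g0 z : (0 <= g z)%E by rewrite mule_ge0// lee_fin.
have mg : measurable_fun setT g.
  apply: emeasurable_funM.
    apply: (measurableT_comp (mintegrand a)) => //.
    by apply: measurable_fun_pair => //; apply: measurable_fun_pair.
  by apply/measurable_EFinP; exact: (measurableT_comp mf).
transitivity (\int[@gauss_measure R d]_y \int[lebesgue_measure]_v g (y, v))%E.
  apply: eq_integral => y _; rewrite averaged_mehlerE -ge0_integralZr ?lee_fin//.
  exact: (measurableT_comp (mintegrand a)).
rewrite (fubini_tonelli _ mg g0) [RHS]integral_mkcond.
apply: eq_integral => v _.
rewrite /g /integrand /patch/=; case: ifPn => [vp|vn]; last first.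
  by rewrite integral0_eq// => y _; rewrite mul0r mul0e.
rewrite -ge0_integralZl ?lee_fin ?weight_ge0//.
- by apply: eq_integral => y _; rewrite -EFinM -mulrA EFinM.
- apply/measurable_EFinP; apply: measurable_funM => //; exact: measurable_mehler.
- by move=> y _; rewrite lee_fin; apply: mulr_ge0 => //; exact: mehler_ge0.
Qed.

Lemma averaged_mehler_marginal a : 0 < a -> 2 * a <= 1 ->
  exists2 B : R, 0 <= B & forall x,
    (\int[@gauss_measure R d]_y averaged_mehler a (x, y) <= B%:E)%E.
Proof.
move=> a0 a1; have [B B0 HB] := integral_weight_lty 0 q0 a0 a1.
exists B => // x; apply: le_trans HB.
rewrite (eq_integral (fun y => averaged_mehler a (x, y) * 1%:E)%E); last first.
  by move=> y _; rewrite mule1.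
rewrite (integral_averaged_mehler _ _ (f := cst 1))//.
apply: ge0_le_integral_nonmeasurable => v /=; rewrite in_itv/= andbT => v0.
  rewrite mule_ge0 ?lee_fin ?weight_ge0//; apply: integral_ge0 => y _.
  by rewrite lee_fin mulr1 mehler_ge0.
under eq_integral do rewrite mulr1.
by rewrite integral_mehler ?ratio_bounds// mule1 expr0 mulr1.
Qed.

Lemma averaged_mehler_modular a (p : d.-tuple R -> R) :
  0 < a -> 2 * a <= 1 -> P_gauss_infty p ->
  exists D B : R, [/\ 0 < D, 0 < B & forall f : d.-tuple R -> R,
    measurable_fun setT f -> (forall x, 0 <= f x) ->
    (\int[@gauss_measure R d]_x (f x `^ p x)%:E <= 1)%E ->
    (\int[@gauss_measure R d]_x
      ((\int[@gauss_measure R d]_y (averaged_mehler a (x, y) * (f y)%:E))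
        * (D^-1)%:E) `^ p x <= B%:E)%E].
Proof.
move=> a0 a1 [mp p1 [C [pinf [C0 pinf1 Hp]]]].
have [B B0 HB] := averaged_mehler_marginal a0 a1.
have [C' C'0 HC'] := averaged_mehler_le a0 a1.
pose K := expR (2 * C).
have K1 : 1 <= K by rewrite -expR0 ler_expR; lra.
exists (B + K + K * C'), (1 + B); split.
- have : 0 <= K * C' by rewrite mulr_ge0// expR_ge0.
  lra.
- lra.
move=> f mf f0 fp.
have -> : ((1 + B)%:E = @gauss_measure R d setT + B%:E)%E.
  by rewrite probability_setT.
pose m x y := expR (Num.min (enorm x ^+ 2) (enorm y ^+ 2)).
have m1 x y : 1 <= m x y.
  by rewrite /m -[leLHS]expR0 ler_expR le_min !sqr_ge0.
have HBl y : (\int[@gauss_measure R d]_x averaged_mehler a (x, y) <= B%:E)%E.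
  by under eq_integral do rewrite averaged_mehlerC.
apply: (schur_modular B0 C'0 (measurable_averaged_mehler a)
  (averaged_mehler_ge0 a) HB HBl HC' m1 K1 _ mp p1 mf f0 fp).
move=> x y; rewrite /m -expRM ler_expR.
(* The decay of [p] says nothing at the origin, but there the minimum, hence the whole exponent, is
   0. *)
have [x0|x0] := eqVneq (enorm x) 0.
  by rewrite x0 expr0n/= (min_l (sqr_ge0 _)) mul0r; lra.
have [y0|y0] := eqVneq (enorm y) 0.
  by rewrite y0 expr0n/= (min_r (sqr_ge0 _)) mul0r; lra.
have en0 (z : d.-tuple R) : enorm z != 0 -> z != nseq_tuple d 0.
  apply: contra => /eqP ->; rewrite /enorm /dotp big1 ?sqrtr0// => i _.
  by rewrite tnth_nseq mul0r.
have ep (z : d.-tuple R) : enorm z != 0 -> 0 < enorm z ^+ 2.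
  by move=> z0; rewrite lt_neqAle sqr_ge0 andbT eq_sym sqrf_eq0.
have pE (z : d.-tuple R) : enorm z != 0 -> enorm z ^+ 2 * `|p z - pinf| <= C.
  move=> z0; rewrite mulrC -ler_pdivlMr ?ep//; exact/Hp/en0.
set N := Num.min _ _.
have N0 : 0 <= N by rewrite le_min !sqr_ge0.
have Nx : N * `|p x - pinf| <= C.
  by apply: le_trans (pE x x0); rewrite ler_wpM2r// ge_min lexx.
have Ny : N * `|p y - pinf| <= C.
  by apply: le_trans (pE y y0); rewrite ler_wpM2r// ge_min lexx orbT.
apply: (@le_trans _ _ (N * (`|p x - pinf| + `|p y - pinf|))); last first.
  by rewrite mulrDr; lra.
rewrite ler_wpM2l//.
have := ler_norm (p x - pinf); have := ler_norm (- (p y - pinf)); rewrite normrN; lra.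
Qed.

End averaged_mehler.

(** * Time derivatives of the subordination kernel *)

Section poisson_kernel_derivatives.
Context {R : realType}.

(** Induction along [p * 'X + b]: half of the Gaussian goes to [p] by induction, the other half
    absorbs the new factor [z]. *)
Lemma horner_gauss_bounded (p : {poly R}) (c : R) : 0 < c ->
  exists2 C : R, 0 < C & forall z, 0 <= z -> `|p.[z]| * expR (- (c * z ^+ 2)) <= C.
Proof.
elim/poly_ind: p c => [|p b IH] c c0.
  by exists 1 => // z _; rewrite horner0 normr0 mul0r.
have c2 : 0 < c / 2 by lra.
have [C C0 HC] := IH _ c2.
have [E E0 HE] := @exprn_expRN_bounded R 1 _ c2.
exists (C * (E + expR (c / 2)) + `|b| + 1) => [|z z0].
  by rewrite ltr_wpDl// addr_ge0// mulr_ge0// ?addr_ge0 ?expR_ge0// ltW.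
have e1 : expR (- (c * z ^+ 2)) <= 1.
  by rewrite -[leRHS]expR0 ler_expR oppr_le0 mulr_ge0 ?sqr_ge0// ltW.
have ze : z * expR (- (c / 2 * z ^+ 2)) <= E + expR (c / 2).
  have [z1|z1] := leP z 1.
    apply: (@le_trans _ _ 1); last first.
      have : 1 <= expR (c / 2) by rewrite -[leLHS]expR0 ler_expR ltW.
      lra.
    rewrite -[leRHS]mulr1; apply: ler_pM => //.
    by rewrite -[leRHS]expR0 ler_expR oppr_le0 mulr_ge0 ?sqr_ge0// ltW.
  apply: (@le_trans _ _ E); last by rewrite lerDl expR_ge0.
  apply: le_trans (HE _ z0); rewrite expr1 ler_wpM2l// ler_expR lerN2.
  by rewrite ler_wpM2l ?(ltW c2)// expr2 ler_peMl// ltW.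
rewrite hornerMXaddC.
apply: (@le_trans _ _ ((`|p.[z]| * z + `|b|) * expR (- (c * z ^+ 2)))).
  rewrite ler_wpM2r ?expR_ge0// (le_trans (ler_normD _ _))//.
  by rewrite normrM (ger0_norm z0).
rewrite mulrDl.
have h2 : `|b| * expR (- (c * z ^+ 2)) <= `|b| by rewrite ler_piMr.
have h1 : `|p.[z]| * z * expR (- (c * z ^+ 2)) <= C * (E + expR (c / 2)).
  rewrite (_ : - (c * z ^+ 2) = - (c / 2 * z ^+ 2) + - (c / 2 * z ^+ 2)); last by field.
  rewrite expRD mulrACA; apply: ler_pM; rewrite ?mulr_ge0 ?expR_ge0//.
  exact: HC.
lra.
Qed.

(* The [i]-th derivative of [s |-> (1 - 2 s^2) exp (- s^2)], the derivative of
   [s exp (- s^2)], is [hermite_like i] times [exp (- s^2)]. *)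
Fixpoint hermite_like (i : nat) : {poly R} :=
  if i is j.+1 then (hermite_like j)^`() - 2%:P * 'X * hermite_like j
  else 1 - 2%:P * 'X^2.

(* The [j]-th derivative in [t] of [t exp (- (t w)^2)]. *)
Definition poisson_kernel (j : nat) (t w : R) : R :=
  (if j is i.+1 then w ^+ i * (hermite_like i).[t * w] else t)
  * expR (- (t * w) ^+ 2).

(** By homogeneity: [w^i = t^(- i) (t w)^i], so for [j = i + 1] the kernel is [t^(1 - j)] times a
    polynomial in [t w] times a Gaussian. The power is written [t * t^-1 ^+ j] so that [j = 0] is
    included. *)
Lemma poisson_kernel_bound (j : nat) : exists2 C : R, 0 < C &
  forall t w, 0 < t -> 0 <= w ->
    `|poisson_kernel j t w| <= C * (t * t^-1 ^+ j) * expR (- (2^-1 * (t * w) ^+ 2)).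
Proof.
case: j => [|i].
  exists 1 => // t w t0 w0; rewrite /poisson_kernel normrM (gtr0_norm t0).
  rewrite ger0_norm ?expR_ge0// expr0 mul1r mulr1 ler_wpM2l ?(ltW t0)// ler_expR.
  by rewrite lerN2 ler_piMl ?sqr_ge0//; lra.
have [C C0 HC] := @horner_gauss_bounded ('X^i * hermite_like i) 2^-1 ltac:(lra).
exists C => // t w t0 w0; rewrite /poisson_kernel.
have tw0 : 0 <= t * w by rewrite mulr_ge0// ltW.
have -> : w ^+ i * (hermite_like i).[t * w] =
    (t * t^-1 ^+ i.+1) * ('X^i * hermite_like i).[t * w].
  have tE : t * t^-1 ^+ i.+1 * t ^+ i = 1.
    have tn0 : t != 0 by rewrite gt_eqF.
    by rewrite exprS mulrA mulfV// mul1r -exprMn mulVf// expr1n.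
  by rewrite hornerM hornerXn exprMn -[LHS]mul1r -tE !mulrA.
rewrite (_ : - (t * w) ^+ 2 = - (2^-1 * (t * w) ^+ 2) + - (2^-1 * (t * w) ^+ 2)); last by field.
rewrite expRD mulrA normrM (ger0_norm (expR_ge0 _)) ler_wpM2r ?expR_ge0//.
rewrite normrM (ger0_norm (expR_ge0 _)) normrM -mulrA (mulrC C).
rewrite ger0_norm; last by rewrite mulr_ge0 ?exprn_ge0 ?invr_ge0// ltW.
rewrite ler_wpM2l//; first by rewrite mulr_ge0 ?exprn_ge0 ?invr_ge0// ltW.
exact: HC.
Qed.

Lemma is_derive_horner_gauss (p : {poly R}) (z : R) :
  is_derive z (1 : R) (fun s => p.[s] * expR (- s ^+ 2))
    ((p^`() - 2%:P * 'X * p).[z] * expR (- z ^+ 2)).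
Proof.
have h2 : is_derive z (1 : R) (expR \o horner (- 'X^2))
    (expR (- z ^+ 2) * (- (2 * z))).
  apply: is_derive_eq.
  by rewrite derivN derivXn !hornerE/=; ring.
have := is_deriveM (is_derive_poly p z) h2.
rewrite (_ : _ * _ = fun s => p.[s] * expR (- s ^+ 2)); last first.
  by apply/funext => s; rewrite fctE /= !hornerE.
move/is_derive_eq; apply; rewrite /= /GRing.scale/= !hornerE/=.
by ring.
Qed.

Lemma is_derive_poisson_kernel (j : nat) (t w : R) :
  is_derive t (1 : R) (fun s => poisson_kernel j s w) (poisson_kernel j.+1 t w).
Proof.
have hw : is_derive t (1 : R) (horner (w *: 'X)) w.
  by apply: is_derive_eq; rewrite derivZ derivX !hornerE.
have hp p : is_derive t (1 : R) ((fun z => p.[z] * expR (- z ^+ 2)) \o horner (w *: 'X))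
   ((p^`() - 2%:P * 'X * p).[t * w] * expR (- (t * w) ^+ 2) * w).
  apply: is_derive1_comp; rewrite (_ : (w *: 'X).[t] = t * w).
    exact: is_derive_horner_gauss.
  by rewrite hornerZ hornerX mulrC.
case: j => [|i]; rewrite /poisson_kernel.
  have := is_deriveM (is_derive_id t (1 : R)) (hp 1).
  rewrite (_ : _ * _ = fun s => s * expR (- (s * w) ^+ 2)); last first.
    apply/funext => s.
    rewrite -[LHS]/(s * ((1 : {poly R}).[(w *: 'X).[s]] * expR (- (w *: 'X).[s] ^+ 2))).
    by rewrite hornerZ hornerX hornerC mul1r (mulrC w).
  move/is_derive_eq; apply; rewrite /GRing.scale/= -polyC1 derivC.
  by rewrite !hornerE/= (mulrC w); ring.
have := is_deriveZ (w ^+ i) (hp (hermite_like i)).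
rewrite (_ : _ \*: _ = fun s => w ^+ i * (hermite_like i).[s * w] * expR (- (s * w) ^+ 2)); last first.
  apply/funext => s.
  rewrite -[LHS]/(w ^+ i * ((hermite_like i).[(w *: 'X).[s]] * expR (- (w *: 'X).[s] ^+ 2))).
  by rewrite hornerZ hornerX (mulrC w) mulrA.
move/is_derive_eq; apply.
rewrite (_ : hermite_like i.+1 = (hermite_like i)^`() - 2%:P * 'X * hermite_like i)//.
by move: (_.[t * w]) => y; rewrite /GRing.scale/= (exprS w i); ring.
Qed.

Lemma measurable_poisson_kernel (j : nat) (t : R) :
  measurable_fun setT (poisson_kernel j t).
Proof.
have mh (p : {poly R}) : measurable_fun setT (fun w => p.[t * w]).
  apply: (@measurableT_comp _ _ _ _ _ _ (horner p)) => //.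
  by apply: continuous_measurable_fun; exact: continuous_horner.
have me : measurable_fun setT (fun w => expR (- (t * w) ^+ 2)).
  apply: measurableT_comp => //; apply: measurableT_comp => //.
  by apply: measurable_funX; exact: measurable_funM.
case: j => [|i]; rewrite /poisson_kernel; first exact: measurable_funM.
by apply: measurable_funM => //; apply: measurable_funM => //.
Qed.

End poisson_kernel_derivatives.

(** * Dilations of the half-line *)

Section scaling.
Context {R : realType}.

Let preimage_scale_itvoc (c a b : R) : 0 < c ->
  (fun v => c * v) @^-1` `]a, b] = `]c^-1 * a, c^-1 * b]%classic.
Proof.
move=> c0; apply/seteqP; split => v /=; rewrite !in_itv/=.
  by rewrite ltr_pdivrMl// ler_pdivlMl.
by rewrite ltr_pdivrMl// ler_pdivlMl.
Qed.

Let measurable_scale (c : R) :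
  measurable_fun setT ( *%R c : measurableTypeR R -> measurableTypeR R).
Proof.
have m : measurable_fun (setT : set R) ( *%R c : R -> R) by exact: measurable_funM.
by move=> mD Y mY; exact: (m mD Y mY).
Qed.

(** By uniqueness of Lebesgue measure: [c] times its image under multiplication by [c] has the right
    value on half-open intervals. *)
Lemma lebesgue_measure_scale (c : R) (A : set R) : 0 < c ->
  measurable (A : set (measurableTypeR R)) ->
  (lebesgue_measure A = c%:E * lebesgue_measure ( *%R c @^-1` A))%E.
Proof.
move=> c0 mA.
pose k := NngNum (ltW c0).
pose m : {measure set (measurableTypeR R) -> \bar R} :=
  measure_function_pushforward__canonical__measure_function_Measure
    lebesgue_measure (measurable_scale c).
rewrite (lebesgue_measure_unique (mu := mscale k m) _ mA)//= => _ [[a b]] _ <-.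
rewrite /mscale/= /pushforward preimage_scale_itvoc//.
rewrite !lebesgue_measure_itv/= !lte_fin ltr_pM2l ?invr_gt0//.
case: ifPn => _; last by rewrite mule0.
by rewrite -!EFinD -EFinM; congr EFin; field; rewrite gt_eqF.
Qed.

Lemma ge0_integral_scale (c : R) (f : R -> \bar R) : 0 < c ->
  measurable_fun (`]0, +oo[ : set R) f -> (forall u, 0 < u -> (0 <= f u)%E) ->
  (\int[lebesgue_measure]_(u in `]0%R, +oo[) f u =
   \int[lebesgue_measure]_(v in `]0%R, +oo[) (f (c * v)%R * c%:E))%E.
Proof.
move=> c0 mf f0.
have mD : measurable (`]0, +oo[ : set R) by exact: measurable_itv.
rewrite integral_mkcond [RHS]integral_mkcond.
rewrite (@ge0_integral_density _ _ _ _ _ lebesgue_measure lebesgue_measure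
  ( *%R c) (cst c))//; last 4 first.
- by move=> v; exact: ltW.
- move=> A mA; rewrite [RHS](_ : _ =
    \int[lebesgue_measure]_(x in *%R c @^-1` A) cst c%:E x)%E//.
  have mcA := measurable_scale c measurableT mA; rewrite setTI in mcA.
  by rewrite integral_cst//; exact: lebesgue_measure_scale.
- exact: measurable_fun_TypeR ((measurable_restrictT f mD).1 mf).
- by apply: erestrict_ge0 => u /=; rewrite in_itv/= andbT; exact: f0.
apply: eq_integral => v _; rewrite /patch.
have -> : (c * v \in `]0, +oo[%classic) = (v \in `]0, +oo[%classic).
  by apply/idP/idP; rewrite !inE/= !in_itv/= !andbT pmulr_rgt0.
by case: ifPn => // _; rewrite mul0e.
Qed.

Lemma integral_scale (c : R) (g : R -> R) : 0 < c ->
  measurable_fun (`]0, +oo[ : set R) g ->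
  (\int[lebesgue_measure]_(u in `]0%R, +oo[) (g u)%:E =
   \int[lebesgue_measure]_(v in `]0%R, +oo[) (g (c * v) * c)%:E)%E.
Proof.
move=> c0 mg; have mEg : measurable_fun (`]0, +oo[ : set R) (EFin \o g).
  exact/measurable_EFinP.
rewrite integralE [RHS]integralE; congr (_ - _)%E.
  rewrite (ge0_integral_scale c0)//; last exact: measurable_funepos.
  apply: eq_integral => v _; rewrite !funeposE/= -!EFin_max -EFinM.
  by rewrite maxr_pMl ?ltW// mul0r.
rewrite (ge0_integral_scale c0)//; last exact: measurable_funeneg.
apply: eq_integral => v _; rewrite !funenegE/= -!EFin_max -EFinM.
by rewrite maxr_pMl ?ltW// mul0r mulNr.
Qed.

End scaling.

Lemma poisson_kernel_sqrt_le {R : realType} (j : nat) :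
  exists2 C : R, 0 < C & forall t v : R, 0 < t -> 0 < v ->
  `|poisson_kernel j t (Num.sqrt v)| <=
    C * (t * t^-1 ^+ j) * expR (- (t ^+ 2 / 2 * v)).
Proof.
have [C C0 HC] := @poisson_kernel_bound R j.
exists C => // t v t0 v0; apply: (le_trans (HC _ _ t0 (sqrtr_ge0 v))).
rewrite (_ : 2^-1 * (t * Num.sqrt v) ^+ 2 = t ^+ 2 / 2 * v)//.
by rewrite exprMn sqr_sqrtr ?(ltW v0)//; field.
Qed.

(** * Differentiating the Poisson-Hermite semigroup under the integral *)

Section poisson_hermite_derivatives.
Context {R : realType} (d : nat).
Variables (x : d.-tuple R) (f : d.-tuple R -> R).
Hypothesis mf : measurable_fun setT f.
Hypothesis intf : (\int[@gauss_measure R d]_y `|(f y)%:E| < +oo)%E.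

(** This is [T_s f x] at [s = 1 / (4 v)]. With [u = t^2 v] the subordination time [t^2 / (4 u)]
    becomes [1 / (4 v)], so the semigroup no longer contains [t]. *)
Definition mehler_mean (v : R) : R :=
  \int[@gauss_measure R d]_y (mehler (ratio v) x y * f y).

Let mEmehler v : measurable_fun setT (fun y => mehler (ratio v) x y * f y).
Proof. by apply: measurable_funM => //; exact: measurable_mehler. Qed.

Let mehler_ub v y : 0 < v ->
  mehler (ratio v) x y <= (1 + 2 * v) ^+ d * expR (enorm x ^+ 2).
Proof.
move=> v0; apply: (le_trans (mehler_le _ _ (ratio_bounds v0))).
by rewrite ler_wpM2r ?expR_ge0//; exact: mehler_factor_le.
Qed.

Let norm_mehler v y : `|mehler (ratio v) x y * f y| = mehler (ratio v) x y * `|f y|.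
Proof. by rewrite normrM ger0_norm ?mehler_ge0. Qed.

Let norm_f_fin : (\int[@gauss_measure R d]_y (`|f y|)%:E)%E \is a fin_num.
Proof. by rewrite ge0_fin_numE//; apply: integral_ge0. Qed.

(** Since [x] is fixed in this section, the growth of [exp (|x|^2)] does no harm: this mass is only
    used for integrability. *)
Let mass := expR (enorm x ^+ 2) * fine (\int[@gauss_measure R d]_y (`|f y|)%:E)%E.

Let mass_ge0 : 0 <= mass.
Proof. by rewrite mulr_ge0 ?expR_ge0// fine_ge0//; apply: integral_ge0. Qed.

Lemma mehler_abs_mean_le v : 0 < v ->
  (\int[@gauss_measure R d]_y (mehler (ratio v) x y * `|f y|)%:E <=
   ((1 + 2 * v) ^+ d * mass)%:E)%E.
Proof.
move=> v0; have s0 : 0 <= (1 + 2 * v) ^+ d by rewrite exprn_ge0//; lra.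
rewrite /mass mulrA EFinM fineK// -ge0_integralZl//.
- apply: ge0_le_integral_nonmeasurable => y _.
    by rewrite lee_fin; apply: mulr_ge0 => //; exact: mehler_ge0.
  by rewrite -EFinM lee_fin ler_wpM2r//; exact: mehler_ub.
- by apply/measurable_EFinP; exact: measurableT_comp.
- by rewrite lee_fin mulr_ge0 ?expR_ge0.
Qed.

Lemma integrable_mehler v : 0 < v ->
  (@gauss_measure R d).-integrable setT (fun y => (mehler (ratio v) x y * f y)%:E).
Proof.
move=> v0; apply/integrableP; split; first exact/measurable_EFinP.
under eq_integral do rewrite abse_EFin norm_mehler.
by apply: le_lt_trans (mehler_abs_mean_le v0) _; exact: ltry.
Qed.

Lemma norm_mehler_mean_le v : 0 < v ->
  ((`|mehler_mean v|)%:E <=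
   \int[@gauss_measure R d]_y (mehler (ratio v) x y * `|f y|)%:E)%E.
Proof.
move=> v0; have int := integrable_mehler v0.
rewrite /mehler_mean /Rintegral -abse_EFin fineK ?integrable_fin_num//.
apply: (le_trans (le_abse_integral _ _ _)) => //; first exact/measurable_EFinP.
by under eq_integral do rewrite abse_EFin norm_mehler.
Qed.

Lemma ornstein_uhlenbeckE v : 0 < v ->
  ornstein_uhlenbeck (4 * v)^-1 f x = mehler_mean v.
Proof.
move=> v0; rewrite /mehler_mean.
pose E y := expR (- ((ratio v ^+ 2 * (enorm x ^+ 2 + enorm y ^+ 2)
  - 2 * ratio v * dotp x y) / (1 - ratio v ^+ 2))).
have r2 : expR (- 2 * (4 * v)^-1) = ratio v ^+ 2.
  by rewrite /ratio -expRM_natl mulrN mulNr.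
rewrite /ornstein_uhlenbeck r2 -/(ratio v).
set c := (_ `^ _); rewrite -RintegralZl//.
  by apply: eq_Rintegral => y _; rewrite /mehler -/c mulrA.
have c0 : 0 < c.
  rewrite powR_gt0// subr_gt0; have /andP[r0 r1] := ratio_bounds v0.
  by rewrite expr_lt1.
rewrite (_ : EFin \o _ = fun y => (c^-1)%:E * (mehler (ratio v) x y * f y)%:E)%E.
  by apply: integrableZl => //; exact: integrable_mehler.
apply/funext => y; rewrite /mehler -/c /= -EFinM; congr EFin.
by rewrite !mulrA mulVf ?mul1r// gt_eqF.
Qed.

Lemma measurable_mehler_mean : measurable_fun (setT : set R) mehler_mean.
Proof.
pose g (z : R * d.-tuple R) := (mehler (ratio z.1) x z.2 * f z.2)%:E.
have mg : measurable_fun setT g.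
  apply/measurable_EFinP; apply: measurable_funM; last exact: (measurableT_comp mf).
  apply: measurable_mehler => //.
  exact: (measurableT_comp measurable_ratio measurable_fst).
rewrite /mehler_mean /Rintegral; apply: measurableT_comp => //.
(* Tonelli on the positive and negative parts gives measurability at all real [v], including those
   where integrability is not known. *)
rewrite (_ : (fun v => _) = fun v =>
  (fubini_F (@gauss_measure R d) (g^\+)%E v - fubini_F (@gauss_measure R d) (g^\-)%E v)%E).
  apply: emeasurable_funB; apply: measurable_fun_fubini_tonelli_F => //.
    exact: measurable_funepos.
  exact: measurable_funeneg.
apply/funext => v; rewrite integralE; congr (_ - _)%E; apply: eq_integral => y _.
  by rewrite !funeposE.
by rewrite !funenegE.
Qed.

(** Under [u = t^2 v], [exp (- u) u^(-1/2) du] becomes [t exp (- t^2 v) v^(-1/2) dv]. All dependence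
    on [t] sits in the explicit kernel, which can be differentiated. *)
Definition poisson_mean (j : nat) (t : R) : R :=
  \int[lebesgue_measure]_(v in `]0, +oo[)
    (poisson_kernel j t (Num.sqrt v) * ((Num.sqrt v)^-1 * mehler_mean v)).

Let mD : measurable (`]0, +oo[ : set (measurableTypeR R)).
Proof. exact: measurable_itv. Qed.

Let mpoisson j t : measurable_fun (setT : set R)
  (fun v => poisson_kernel j t (Num.sqrt v) * ((Num.sqrt v)^-1 * mehler_mean v)).
Proof.
have ms : measurable_fun (setT : set R) (@Num.sqrt R).
  by apply: continuous_measurable_fun; exact: sqrt_continuous.
apply: measurable_funM; first exact: (measurableT_comp (measurable_poisson_kernel j t) ms).
apply: measurable_funM; last exact: measurable_mehler_mean.
exact: (measurableT_comp measurable_invr ms).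
Qed.

Let invsqrtE (v : R) : 0 < v -> (Num.sqrt v)^-1 = v `^ (2^-1 - 1).
Proof.
move=> v0; rewrite -powR12_sqrt ?ltW// -powRN; congr (_ `^ _); lra.
Qed.

Let weight_bound (c : R) : 0 < c ->
  (lebesgue_measure).-integrable `]0, +oo[
    (fun v : measurableTypeR R => (expR (- (c * v)) * ((Num.sqrt v)^-1 * `|mehler_mean v|))%:E).
Proof.
move=> c0; have [C C0 HC] := @integral_weight_lty R c 2^-1 d c0 ltac:(lra) ltac:(lra).
have h0 v : 0 <= expR (- (c * v)) * ((Num.sqrt v)^-1 * `|mehler_mean v|).
  by rewrite mulr_ge0 ?expR_ge0// mulr_ge0// invr_ge0 sqrtr_ge0.
apply/integrableP; split.
  apply/measurable_EFinP; apply: measurable_fun_TypeR.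
  apply: (@measurable_funS _ _ _ _ setT) => //; apply: measurable_funM.
    by apply: measurableT_comp => //; apply: measurableT_comp => //; exact: measurable_funM.
  apply: measurable_funM.
    apply: (measurableT_comp measurable_invr).
    by apply: continuous_measurable_fun; exact: sqrt_continuous.
  by apply: measurableT_comp => //; exact: measurable_mehler_mean.
apply: (@le_lt_trans _ _ (mass%:E * \int[lebesgue_measure]_(v in `]0%R, +oo[)
    (weight c 2^-1 v * (1 + 2 * v) ^+ d)%:E)%E); last first.
  apply: (@le_lt_trans _ _ (mass%:E * C%:E)%E); last by rewrite -EFinM ltry.
  by rewrite lee_wpmul2l.
rewrite -ge0_integralZl//; last 2 first.
- apply/measurable_EFinP; apply: measurable_fun_TypeR.
  apply: (@measurable_funS _ _ _ _ setT) => //; apply: measurable_funM.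
    exact: measurable_weight.
  by apply: measurable_funX; apply: measurable_funD => //.
- move=> v /=; rewrite in_itv/= andbT => v0.
  by rewrite lee_fin mulr_ge0 ?weight_ge0// exprn_ge0//; lra.
apply: ge0_le_integral_nonmeasurable => v /=; rewrite in_itv/= andbT => v0//.
rewrite ger0_norm// -EFinM lee_fin invsqrtE// /weight.
rewrite [leRHS]mulrC -!mulrA mulrCA ler_wpM2l ?powR_ge0// ler_wpM2l ?expR_ge0//.
rewrite -lee_fin; apply: (le_trans (norm_mehler_mean_le v0)).
exact: mehler_abs_mean_le.
Qed.

Let integrable_poisson (j : nat) (t : R) : 0 < t ->
  (lebesgue_measure).-integrable `]0, +oo[ (fun v : measurableTypeR R =>
    (poisson_kernel j t (Num.sqrt v) * ((Num.sqrt v)^-1 * mehler_mean v))%:E).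
Proof.
move=> t0; have [C C0 HC] := @poisson_kernel_sqrt_le R j.
have c0 : 0 < t ^+ 2 / 2 by rewrite divr_gt0// exprn_gt0.
have A0 : 0 <= C * (t * t^-1 ^+ j).
  by rewrite mulr_ge0 ?(ltW C0)// mulr_ge0 ?exprn_ge0 ?invr_ge0 ?(ltW t0).
apply: (le_integrable mD _ _ (integrableZl mD (C * (t * t^-1 ^+ j)) (weight_bound c0))).
  apply/measurable_EFinP; apply: measurable_fun_TypeR.
  by apply: (@measurable_funS _ _ _ _ setT) => //; exact: mpoisson.
move=> v /=; rewrite in_itv/= andbT => v0; rewrite lee_fin.
rewrite [leRHS]ger0_norm; last first.
  by rewrite mulr_ge0// mulr_ge0 ?expR_ge0// mulr_ge0 ?invr_ge0 ?sqrtr_ge0.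
have s0 : 0 <= (Num.sqrt v)^-1 by rewrite invr_ge0 sqrtr_ge0.
rewrite normrM [X in _ * X]normrM (ger0_norm s0) [leRHS]mulrA.
by rewrite ler_wpM2r ?mulr_ge0//; exact: HC.
Qed.

Lemma is_derive_poisson_mean (j : nat) (t : R) : 0 < t ->
  is_derive t (1 : R) (poisson_mean j) (poisson_mean j.+1 t).
Proof.
move=> t0; have [C C0 HC] := @poisson_kernel_sqrt_le R j.+1.
pose H v := (Num.sqrt v)^-1 * mehler_mean v.
pose F (s : R) (v : measurableTypeR R) := poisson_kernel j s (Num.sqrt v) * H v.
have dF (s v : R) : is_derive s (1 : R) (F ^~ v) (poisson_kernel j.+1 s (Num.sqrt v) * H v).
  have := is_deriveZ (H v) (is_derive_poisson_kernel j s (Num.sqrt v)).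
  rewrite (_ : _ \*: _ = F ^~ v); last by apply/funext => r; rewrite /F mulrC.
  by move/is_derive_eq; apply; rewrite /GRing.scale/= mulrC.
have pF s v : partial1of2 F s v = poisson_kernel j.+1 s (Num.sqrt v) * H v.
  by rewrite /partial1of2 derive1E; case: (dF s v).
(* On the window []t / 2, 2 t[] the bound on the kernel at time [s] is dominated by taking [2 t] for
   the factor [s] and [t / 2] both in [s^-1] and in the exponential. *)
pose c := (t / 2) ^+ 2 / 2.
have t2 : 0 < t / 2 by lra.
have c0 : 0 < c by rewrite divr_gt0// exprn_gt0.
pose K := C * (2 * t * (t / 2)^-1 ^+ j.+1).
have K0 : 0 <= K.
  by rewrite /K mulr_ge0 ?(ltW C0)// mulr_ge0 ?exprn_ge0 ?invr_ge0 ?(ltW t2)//; lra.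
pose G (v : measurableTypeR R) :=
  K * (expR (- (c * v)) * ((Num.sqrt v)^-1 * `|mehler_mean v|)).
have It : `]t / 2, 2 * t[%classic t by rewrite /= in_itv/=; apply/andP; split; lra.
have G0 v : 0 <= G v.
  by rewrite /G mulr_ge0// mulr_ge0 ?expR_ge0// mulr_ge0 ?invr_ge0 ?sqrtr_ge0.
have intF s : `]t / 2, 2 * t[%classic s ->
    (lebesgue_measure).-integrable `]0, +oo[ (EFin \o F s).
  by rewrite /= in_itv/= => /andP[s1 _]; apply: integrable_poisson; lra.
have derF s v : `]t / 2, 2 * t[%classic s -> `]0, +oo[%classic v ->
    derivable (F ^~ v) s 1.
  by move=> _ _; case: (dF s v).
have intG : (lebesgue_measure).-integrable `]0, +oo[ (EFin \o G).
  exact: (integrableZl mD K (weight_bound c0)).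
have Gub s v : `]t / 2, 2 * t[%classic s -> `]0, +oo[%classic v ->
    `|partial1of2 F s v| <= G v.
  rewrite /= !in_itv/= andbT => /andP[s1 s2] v0; rewrite pF /G /H.
  have s0 : 0 < s by lra.
  have q0 : 0 <= (Num.sqrt v)^-1 by rewrite invr_ge0 sqrtr_ge0.
  rewrite normrM [X in _ * X]normrM (ger0_norm q0) [leRHS]mulrA.
  rewrite ler_wpM2r ?mulr_ge0//; apply: (le_trans (HC _ _ s0 v0)).
  apply: ler_pM; rewrite ?expR_ge0//.
  - by rewrite mulr_ge0 ?(ltW C0)// mulr_ge0 ?exprn_ge0 ?invr_ge0 ?(ltW s0).
  - rewrite /K ler_wpM2l ?(ltW C0)//; apply: ler_pM; rewrite ?(ltW s0) ?(ltW s2)//.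
      by rewrite exprn_ge0// invr_ge0 ltW.
    rewrite lerXn2r ?nnegrE ?invr_ge0 ?(ltW s0) ?(ltW t2)//.
    by rewrite lef_pV2 ?posrE// ltW.
  - rewrite ler_expR lerN2 ler_wpM2r ?(ltW v0)// ler_wpM2r//.
    by rewrite lerXn2r ?nnegrE ?(ltW s0) ?(ltW t2) ?(ltW s1).
have D1 := differentiation_under_integral mD It intF derF G0 intG Gub.
have D2 := derivable_under_integral mD It intF derF G0 intG Gub.
apply: DeriveDef => //; rewrite -derive1E [LHS]D1.
by apply: eq_Rintegral => v _; rewrite pF.
Qed.

Lemma poisson_hermiteE (t : R) : 0 < t ->
  poisson_hermite t f x = (Num.sqrt pi)^-1 * poisson_mean 0 t.
Proof.
move=> t0; rewrite /poisson_hermite; congr (_ * _); rewrite /poisson_mean /Rintegral; congr fine.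
have t2 : 0 < t ^+ 2 by rewrite exprn_gt0.
have key (v : R) : 0 < v ->
    expR (- (t ^+ 2 * v)) / Num.sqrt (t ^+ 2 * v) * mehler_mean (t ^+ 2 * v / t ^+ 2)
      * t ^+ 2 =
    poisson_kernel 0 t (Num.sqrt v) * ((Num.sqrt v)^-1 * mehler_mean v).
  move=> v0; rewrite (mulrC (t ^+ 2) v) mulfK ?gt_eqF// (mulrC v).
  rewrite /poisson_kernel exprMn sqr_sqrtr ?(ltW v0)//.
  rewrite sqrtrM ?(ltW t2)// sqrtr_sqr (gtr0_norm t0) invfM.
  by field; rewrite !gt_eqF// sqrtr_gt0.
pose g (u : R) := expR (- u) / Num.sqrt u * mehler_mean (u / t ^+ 2).
have mg : measurable_fun (`]0, +oo[ : set R) g.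
  apply: (@measurable_funS _ _ _ _ setT) => //.
  apply: measurable_funM; last first.
    by apply: (measurableT_comp measurable_mehler_mean); exact: measurable_funM.
  apply: measurable_funM; first by apply: measurableT_comp => //.
  apply: (measurableT_comp measurable_invr).
  by apply: continuous_measurable_fun; exact: sqrt_continuous.
transitivity (\int[lebesgue_measure]_(u in `]0%R, +oo[) (g u)%:E)%E.
  apply: eq_integral => u; rewrite inE/= in_itv/= andbT => u0; rewrite /g.
  have v0 : 0 < (u : R) / t ^+ 2 by rewrite divr_gt0.
  rewrite -(ornstein_uhlenbeckE v0) (_ : (4 * ((u : R) / t ^+ 2))^-1 = t ^+ 2 / (4 * u))//.
  by field; rewrite !gt_eqF.
rewrite (integral_scale t2 mg); apply: eq_integral => v.
by rewrite inE/= in_itv/= andbT => v0; rewrite /g key.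
Qed.

Lemma derive1n_poisson_hermite (k : nat) (t : R) : 0 < t ->
  derive1n k (fun s => poisson_hermite s f x) t =
  (Num.sqrt pi)^-1 * poisson_mean k t.
Proof.
elim: k t => [|k IH] t t0; first exact: poisson_hermiteE.
rewrite /derive1n iterS -/(derive1n k _) derive1E.
(* The formula of order [k] is known for positive times only; these form a neighbourhood of [t],
   which is enough for the derivative. *)
rewrite (@near_eq_derive _ _ _ _ ((Num.sqrt pi)^-1 \*: poisson_mean k)) ?oner_eq0//.
  by have := is_deriveZ (Num.sqrt pi)^-1 (is_derive_poisson_mean k t0) => -[_ ->].
by near=> s; apply: IH; near: s; exact: lt_nbhsr.
Unshelve. all: by end_near. Qed.

Lemma norm_poisson_mean_le (C c : R) (w : R -> R) (j : nat) (t : R) : 0 < t -> 0 <= c ->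
  measurable_fun setT w -> (forall v, 0 <= w v) ->
  (forall v, 0 < v ->
    `|poisson_kernel j t (Num.sqrt v)| * (Num.sqrt v)^-1 <= c * w v) ->
  ((`|poisson_mean j t|)%:E <= c%:E *
    \int[lebesgue_measure]_(v in `]0%R, +oo[) ((w v)%:E *
      \int[@gauss_measure R d]_y (mehler (ratio v) x y * `|f y|)%:E))%E.
Proof.
move=> t0 c0 mw w0 Hw.
pose S v := (\int[@gauss_measure R d]_y (mehler (ratio v) x y * `|f y|)%:E)%E.
have S0 v : (0 <= S v)%E.
  apply: integral_ge0 => y _; rewrite lee_fin; apply: mulr_ge0 => //.
  exact: mehler_ge0.
have mS : measurable_fun (setT : set R) S.
  apply: (measurable_fun_fubini_tonelli_F (T1 := R)
    (fun z => (mehler (ratio z.1) x z.2 * `|f z.2|)%:E)).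
    apply/measurable_EFinP; apply: measurable_funM.
      apply: measurable_mehler => //.
      exact: (measurableT_comp measurable_ratio measurable_fst).
    by apply: measurableT_comp => //; exact: (measurableT_comp mf).
  by move=> z; rewrite lee_fin; apply: mulr_ge0 => //; exact: mehler_ge0.
rewrite -ge0_integralZl//; last 2 first.
- apply: measurable_fun_TypeR; apply: (@measurable_funS _ _ _ _ setT) => //.
  by apply: emeasurable_funM => //; exact/measurable_EFinP.
- by move=> v _; apply: mule_ge0; [rewrite lee_fin|exact: S0].
have ip := integrable_poisson j t0.
rewrite /poisson_mean /Rintegral -abse_EFin fineK ?integrable_fin_num//.
apply: (le_trans (le_abse_integral _ mD _)); first by case/integrableP : ip.
apply: ge0_le_integral_nonmeasurable => v /=; first by rewrite lee_fin.
rewrite in_itv/= andbT => v0.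
have q0 : 0 <= (Num.sqrt v)^-1 by rewrite invr_ge0 sqrtr_ge0.
rewrite normrM [X in _ * X]normrM (ger0_norm q0) mulrA EFinM muleA.
apply: lee_pmul; rewrite ?lee_fin ?mulr_ge0//.
  exact: Hw.
exact: norm_mehler_mean_le.
Qed.

End poisson_hermite_derivatives.

(* For [t >= 1] the derivatives of the Poisson-Hermite semigroup are controlled
   by one average of the Ornstein-Uhlenbeck semigroup, in place of the maximal
   function (unbounded where [p] takes the value 1). *)
Lemma poisson_mean_large_time {R : realType} (d j : nat) (a : R) :
  0 < a -> 2 * a <= 1 -> exists2 C : R, 0 < C &
  forall (x : d.-tuple R) (f : d.-tuple R -> R), measurable_fun setT f ->
  (\int[@gauss_measure R d]_y `|(f y)%:E| < +oo)%E ->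
  forall t, 1 <= t -> ((`|poisson_mean x f j t|)%:E <=
    (C * (t `^ (2 * a) * t^-1 ^+ j))%:E *
    \int[@gauss_measure R d]_y (averaged_mehler a (x, y) * (`|f y|)%:E))%E.
Proof.
move=> a0 a1; have [C C0 HC] := @poisson_kernel_sqrt_le R j.
exists (C * 4); first by rewrite mulr_gt0.
move=> x f mf intf t t1; have t0 : 0 < t by lra.
rewrite integral_averaged_mehler//; last exact: measurableT_comp.
apply: norm_poisson_mean_le => //.
- by rewrite !mulr_ge0 ?(ltW C0) ?powR_ge0// exprn_ge0// invr_ge0 ltW.
- exact: measurable_weight.
- exact: weight_ge0.
(* Trade powers of [v] for powers of [t]: [v^(-1/2) = z^(1/2 - a) t^(2 a - 1) v^(a - 1)]. Of
   [exp (- z / 2)], one half bounds [z^(1/2 - a)], through [z^(1/2 - a) <= 1 + z <= 4 exp (z / 4)];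
   the other is at most [exp (- v / 4)] as [t >= 1]. *)
move=> v v0; pose z := t ^+ 2 * v.
have z0 : 0 < z by rewrite mulr_gt0// exprn_gt0.
have zE : z `^ (2^-1 - a) * expR (- (z / 4)) <= 4.
  apply: (@le_trans _ _ ((1 + z) * expR (- (z / 4)))).
    rewrite ler_wpM2r ?expR_ge0//; have [z1|z1] := leP z 1.
      apply: (@le_trans _ _ (1 `^ (2^-1 - a))); last by rewrite powR1; lra.
      by apply: ge0_ler_powR => //; rewrite ?nnegrE; lra.
    apply: (@le_trans _ _ z); last lra.
    by rewrite -[leRHS](powRr1 (ltW z0)); apply: ler_powR; lra.
  rewrite expRN ler_pdivrMr ?expR_gt0//.
  by have := expR_ge1Dx (z / 4); lra.
have kE : expR (- (t ^+ 2 / 2 * v)) * (Num.sqrt v)^-1 <=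
    4 * (t `^ (2 * a) / t * weight 4^-1 a v).
  have -> : (Num.sqrt v)^-1 = z `^ (2^-1 - a) * (t `^ (2 * a) / t) * v `^ (a - 1).
    have tn0 : t != 0 by rewrite gt_eqF.
    rewrite /z powRM ?(ltW v0) ?exprn_ge0 ?(ltW t0)//.
    rewrite -(powR_mulrn 2 (ltW t0)) -powRrM.
    have -> : t `^ (2%:R * (2^-1 - a)) = t * (t `^ (2 * a))^-1.
      rewrite (_ : 2%:R * (2^-1 - a) = 1 - 2 * a); last by field.
      by rewrite powRD ?tn0 ?implybT// powRr1 ?(ltW t0)// powRN.
    rewrite (_ : _ * _ * v `^ (a - 1) = v `^ (2^-1 - a) * v `^ (a - 1)); last first.
      by field; rewrite tn0 gt_eqF// powR_gt0.
    rewrite -powRD ?(gt_eqF v0) ?implybT// -powR12_sqrt ?(ltW v0)// -powRN.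
    by congr (_ `^ _); lra.
  rewrite (_ : - (t ^+ 2 / 2 * v) = - (z / 4) + - (z / 4)); last by rewrite /z; field.
  rewrite expRD /weight (_ : _ * _ = z `^ (2^-1 - a) * expR (- (z / 4)) *
    (t `^ (2 * a) / t * (v `^ (a - 1) * expR (- (z / 4))))); last by ring.
  have T0 : 0 <= t `^ (2 * a) / t by rewrite divr_ge0 ?powR_ge0// ltW.
  apply: ler_pM => //.
  - by rewrite mulr_ge0 ?powR_ge0 ?expR_ge0.
  - by rewrite mulr_ge0// mulr_ge0 ?powR_ge0 ?expR_ge0.
  rewrite ler_wpM2l// ler_wpM2l ?powR_ge0// ler_expR lerN2 mulrC.
  by rewrite ler_wpM2r// /z ler_peMl ?(ltW v0)// exprn_ege1.
apply: (le_trans (ler_wpM2r _ (HC _ _ t0 v0))).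
  by rewrite invr_ge0 sqrtr_ge0.
apply: (@le_trans _ _ (C * (t * t^-1 ^+ j) *
    (4 * (t `^ (2 * a) / t * weight 4^-1 a v)))).
  rewrite -(mulrA (C * _)) ler_wpM2l//.
  by rewrite mulr_ge0 ?(ltW C0)// mulr_ge0 ?exprn_ge0 ?invr_ge0 ?(ltW t0).
rewrite (_ : C * (t * t^-1 ^+ j) * _ =
  C * 4 * (t `^ (2 * a) * t^-1 ^+ j) * weight 4^-1 a v)//.
move: (t^-1 ^+ j) (t `^ (2 * a)) (weight _ _ _) => A B W.
by field; rewrite gt_eqF.
Qed.

(** * Recovering lower derivatives on []0, 1[] *)

Section one_variable_estimates.
Context {R : realType}.

Lemma le1D_powR (z q : R) : 0 <= z -> 1 <= q -> z <= 1 + z `^ q.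
Proof.
move=> z0 q1; have := powR_ge0 z q; have [z1|z1] := leP z 1; first lra.
have := le1r_powR (ltW z1) q1; lra.
Qed.

Lemma powR_le1D (z q1 q2 : R) : 0 <= z -> 0 <= q2 -> q2 <= q1 -> z `^ q2 <= 1 + z `^ q1.
Proof.
move=> z0 q20 q21; have := powR_ge0 z q1; have [z1|z1] := leP z 1.
  have : z `^ q2 <= 1 `^ q2 by apply: ge0_ler_powR => //; rewrite ?nnegrE.
  rewrite powR1; lra.
have := ler_powR (ltW z1) q21; lra.
Qed.

Lemma norm_increment_le_integral (F F' : R -> R) (t : R) : 0 < t < 1 ->
  (forall s : R, 0 < s -> is_derive s (1 : R) F (F' s)) ->
  (forall s : R, 0 < s -> {for s, continuous F'}) ->
  ((`|F 1 - F t|)%:E <= \int[lebesgue_measure]_(s in `[t, 1%R]) (`|F' s|)%:E)%E.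
Proof.
move=> /andP[t0 t1] dF cF'.
have cF (s : R) : 0 < s -> {for s, continuous F}.
  by move=> s0; apply: differentiable_continuous; apply/derivable1_diffP; case: (dF s s0).
have cw : {within `[t, 1%R], continuous F'}.
  apply: continuous_in_subspaceT => s; rewrite inE/= in_itv/= => /andP[ts _].
  by apply: cF'; exact: lt_le_trans ts.
have E : (\int[lebesgue_measure]_(s in `[t, 1%R]) (F' s)%:E = (F 1)%:E - (F t)%:E)%E.
  apply: continuous_FTC2 => //.
  - split.
    + move=> s; rewrite in_itv/= => /andP[ts _].
      by case: (dF s (lt_trans t0 ts)).
    + by apply: cvg_at_right_filter; exact: cF.
    + by apply: cvg_at_left_filter; exact: cF.
  - move=> s; rewrite in_itv/= => /andP[ts _].
    by rewrite derive1E; case: (dF s (lt_trans t0 ts)).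
rewrite -abse_EFin EFinB -E.
apply: (le_trans (le_abse_integral _ _ _)) => //.
apply/measurable_EFinP; apply: measurable_fun_TypeR.
exact: subspace_continuous_measurable_fun.
Qed.

(** In place of a Hoelder inequality, [g / lam <= 1 + (g / lam)^q]: the modular pays for the power.
    The constant 1 leaves the integral of [s^-1], a logarithm, which is absorbed through
    [s^-1 <= s^(- theta - 1)]. *)
Lemma integral_norm_le_modular (F' g q : R -> R) (lam theta t : R) :
  0 < lam -> 0 < theta -> 0 < t < 1 ->
  measurable_fun (`]0, +oo[ : set R) q -> measurable_fun (`]0, +oo[ : set R) g ->
  (forall s, 0 <= g s) -> {ae lebesgue_measure, forall s : R, 0 < s -> 1 <= q s} ->
  (forall s : R, 0 < s <= 1 -> `|F' s| <= s^-1 * g s) ->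
  (\int[dt_over_t]_(s in `]0%R, +oo[) ((g s / lam) `^ q s)%:E <= 1)%E ->
  (\int[lebesgue_measure]_(s in `[t, 1%R]) (`|F' s|)%:E <=
   (lam * (t `^ (- theta) / theta + 1))%:E)%E.
Proof.
move=> l0 th0 /andP[t0 t1] mq mg g0 q1 F'g mod1.
have mH : measurable_fun (`]0, +oo[ : set R) (fun s => ((g s / lam) `^ q s)%:E).
  apply/measurable_EFinP; apply: measurable_fun_powR => //; exact: measurable_funM.
move: mod1; rewrite ge0_integral_dt_over_t//; last first.
  by move=> s _; rewrite lee_fin powR_ge0.
move=> mod1.
apply: (@le_trans _ _ (\int[lebesgue_measure]_(s in `[t, 1%R])
    (lam%:E * (((g s / lam) `^ q s)%:E * (s^-1)%:E)) +
  \int[lebesgue_measure]_(s in `[t, 1%R]) (lam%:E * (s `^ (- theta - 1))%:E))%E).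
  apply: ae_le_integral_add => //.
  - move=> s /=; rewrite in_itv/= => /andP[ts _]; rewrite -!EFinM lee_fin.
    have s0 : 0 < s by exact: lt_le_trans ts.
    by rewrite mulr_ge0 ?(ltW l0)// mulr_ge0 ?powR_ge0// invr_ge0 ltW.
  - by move=> s _; rewrite -EFinM lee_fin mulr_ge0 ?powR_ge0 ?ltW.
  - apply: measurable_funeM; apply/measurable_EFinP; apply: measurable_fun_TypeR.
    by apply: (@measurable_funS _ _ _ _ setT) => //; exact: measurable_powR.
  apply: ae_impl q1 => s qs /=; rewrite in_itv/= => /andP[ts s1].
  have s0 : 0 < s by exact: lt_le_trans ts.
  rewrite -!EFinM -EFinD lee_fin.
  have F's : `|F' s| <= s^-1 * g s by apply: F'g; rewrite s0 s1.
  apply: (le_trans F's).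
  have sV : s^-1 <= s `^ (- theta - 1).
    rewrite -(powR_inv1 (ltW s0)); apply: ger_powR; first by rewrite s0 s1.
    lra.
  have zq := le1D_powR (divr_ge0 (g0 s) (ltW l0)) (qs s0).
  have sV0 : 0 <= s^-1 by rewrite invr_ge0 ltW.
  apply: (@le_trans _ _ (lam * (((g s / lam) `^ q s) * s^-1 + s^-1))); last first.
    by rewrite mulrDr lerD2l ler_wpM2l// ltW.
  rewrite (_ : s^-1 * g s = lam * ((g s / lam) * s^-1)); last first.
    by field; rewrite !gt_eqF.
  rewrite ler_wpM2l ?(ltW l0)// -[X in _ + X]mul1r -mulrDl ler_wpM2r// addrC.
  exact: zq.
rewrite mulrDr addrC EFinD; apply: leeD; last first.
  rewrite mulr1.
  have mV : measurable_fun (`]0, +oo[ : set (measurableTypeR R))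
      (fun s => ((g s / lam) `^ q s)%:E * (s^-1)%:E)%E.
    apply: measurable_fun_TypeR; apply: emeasurable_funM => //.
    by apply/measurable_EFinP; exact: measurable_invr_pos.
  have V0 s : 0 < s -> (0 <= ((g s / lam) `^ q s)%:E * (s^-1)%:E)%E.
    by move=> s0; rewrite -EFinM lee_fin mulr_ge0 ?powR_ge0// invr_ge0 ltW.
  apply: (@le_trans _ _ (\int[lebesgue_measure]_(s in `]0%R, +oo[)
    (lam%:E * (((g s / lam) `^ q s)%:E * (s^-1)%:E)))%E).
    apply: ge0_subset_integral => //.
    - exact: measurable_funeM.
    - move=> s /=; rewrite in_itv/= andbT => s0.
      by apply: mule_ge0; [rewrite lee_fin ltW|exact: V0].
    - move=> s /=; rewrite !in_itv/= andbT => /andP[ts _].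
      exact: lt_le_trans ts.
  rewrite ge0_integralZl//.
  - by rewrite -[leRHS]mule1 lee_wpmul2l// lee_fin ltW.
  - by move=> s /=; rewrite in_itv/= andbT; exact: V0.
  - by rewrite lee_fin ltW.
rewrite ge0_integralZl//; last 3 first.
- apply/measurable_EFinP; apply: measurable_fun_TypeR.
  by apply: (@measurable_funS _ _ _ _ setT) => //; exact: measurable_powR.
- by move=> s _; rewrite lee_fin powR_ge0.
- by rewrite lee_fin ltW.
rewrite integral_powR ?oppr_eq0 ?gt_eqF ?t0 ?t1// -EFinM lee_fin ler_wpM2l ?(ltW l0)//.
by rewrite invrN mulrN -mulNr opprB powR1 ler_wpM2r ?invr_ge0 ?(ltW th0)// gerBl.
Qed.

(* Case [k2 < k1]: since [k1 - 1 <= alpha1], the derivative of order [k1] is at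
   most [s^-1 * s^(k1 - alpha1) |D k1 s|] on [0 < s <= 1]; integrating it gives a
   logarithm, after which the mean value theorem descends to order [k2]. *)
Lemma lower_derivatives_le (D : nat -> R -> R) (q : R -> R)
    (alpha lam Gam theta : R) (k1 : nat) :
  (forall j (t : R), 0 < t -> is_derive t (1 : R) (D j) (D j.+1 t)) ->
  0 < lam -> 0 <= Gam -> 0 < theta -> k1%:R <= alpha ->
  measurable_fun (`]0, +oo[ : set R) q ->
  {ae lebesgue_measure, forall s : R, 0 < s -> 1 <= q s} ->
  (forall j, (j <= k1)%N -> `|D j 1| <= Gam) ->
  (\int[dt_over_t]_(s in `]0%R, +oo[)
     ((`|s `^ (k1.+1%:R - alpha) * D k1.+1 s| / lam) `^ q s)%:E <= 1)%E ->
  forall j (t : R), (j <= k1)%N -> 0 < t < 1 ->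
    `|D j t| <= (k1.+1 - j)%:R * (Gam + lam * (theta^-1 + 1)) * t `^ (- theta).
Proof.
move=> dD l0 G0 th0 ka mq q1 D1 mod1.
have cD j (s : R) : 0 < s -> {for s, continuous (D j)}.
  by move=> s0; apply: differentiable_continuous; apply/derivable1_diffP; case: (dD j s s0).
have cDw j (t : R) : 0 < t -> {within `[t, 1], continuous (D j)}.
  move=> t0; apply: continuous_in_subspaceT => s; rewrite inE/= in_itv/= => /andP[ts _].
  by apply: cD; exact: lt_le_trans ts.
pose M := Gam + lam * (theta^-1 + 1).
have M0 : 0 <= M by rewrite addr_ge0// mulr_ge0 ?(ltW l0)// addr_ge0 ?invr_ge0 ?(ltW th0).
have tth (t : R) : 0 < t < 1 -> 1 <= t `^ (- theta).
  move=> /andP[t0 t1]; rewrite -[leLHS](powRr0 t); apply: ger_powR; last lra.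
  by rewrite t0 ltW.
have top (t : R) : 0 < t < 1 -> `|D k1 t| <= M * t `^ (- theta).
  move=> t01; have /andP[t0 t1] := t01.
  have inc := norm_increment_le_integral t01 (dD k1) (cD k1.+1).
  have mg : measurable_fun (`]0, +oo[ : set R)
      (fun s => `|s `^ (k1.+1%:R - alpha) * D k1.+1 s|).
    apply: measurableT_comp => //; apply: measurable_funM.
      by apply: (@measurable_funS _ _ _ _ setT) => //; exact: measurable_powR.
    apply: open_continuous_measurable_fun; first exact: interval_open.
    by move=> s; rewrite inE/= in_itv/= andbT; exact: cD.
  have g0 s : 0 <= `|s `^ (k1.+1%:R - alpha) * D k1.+1 s| by [].
  have dom (s : R) : 0 < s <= 1 ->
      `|D k1.+1 s| <= s^-1 * `|s `^ (k1.+1%:R - alpha) * D k1.+1 s|.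
    move=> /andP[s0 s1]; rewrite normrM mulrA ler_peMl//.
    rewrite ger0_norm ?powR_ge0// -(powR_inv1 (ltW s0)) -powRD; last first.
      by rewrite (gt_eqF s0) implybT.
    rewrite -[leLHS](powRr0 s); apply: ger_powR; first by rewrite s0.
    by rewrite -natr1; lra.
  have := le_trans inc (integral_norm_le_modular l0 th0 t01 mq mg g0 q1 dom mod1).
  rewrite lee_fin => Dt; have := D1 k1 (leqnn _); have := tth t t01.
  have := ler_distD (D k1 1) 0 (D k1 t); rewrite !sub0r !normrN.
  move: (t `^ (- theta)) Dt => P Dt tri P1 d1.
  apply: (@le_trans _ _ (Gam + lam * (P / theta + 1))); first lra.
  rewrite /M mulrDl; apply: lerD; first by rewrite ler_peMr.
  rewrite -mulrA ler_wpM2l ?(ltW l0)// mulrDl mul1r (mulrC P) lerD2l//.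
(* Downward induction on the order, with [j] written as [k1 - i]. *)
move=> j t jk; rewrite -(subKn jk).
elim: (k1 - j)%N t (leq_subr j k1) => [|i IH] t ik t01.
  by rewrite subn0 subSnn mul1r; exact: top.
have /andP[t0 t1] := t01.
have {}IH := IH _ (ltnW ik).
have kE : (k1 - i = (k1 - i.+1).+1)%N by rewrite subnSK.
(* The value at time 1 is at most [Gam], and the increment is a higher derivative at some [c > t],
   where the induction bound is smaller than at [t]. Each descent therefore adds one [M] to the
   constant. *)
have [c] : exists2 c, c \in `]t, 1[ &
    D (k1 - i.+1)%N 1 - D (k1 - i.+1)%N t = D (k1 - i)%N c * (1 - t).
  apply: MVT => //; last exact: cDw.
  move=> c; rewrite in_itv/= => /andP[tc _]; rewrite kE; apply: dD.
  exact: lt_trans tc.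
rewrite in_itv/= => /andP[tc c1] E.
have c0 : 0 < c by exact: lt_trans tc.
have Dc : `|D (k1 - i)%N c| <= (k1.+1 - (k1 - i))%:R * M * t `^ (- theta).
  apply: (le_trans (IH c _)); first by rewrite c0.
  rewrite ler_wpM2l// ?mulr_ge0//.
  by apply: le0_ler_powR => //; [exact: ltW|lra].
have -> : (k1.+1 - (k1 - i.+1) = (k1.+1 - (k1 - i)).+1)%N.
  by rewrite !subSn ?leq_subr// !subKn// ltnW.
rewrite -natr1 -/M.
have := D1 (k1 - i.+1)%N (leq_subr _ _); have := tth t t01.
have tri := ler_distD (D (k1 - i.+1)%N 1) 0 (D (k1 - i.+1)%N t).
rewrite !sub0r !normrN E normrM in tri.
have n1 : `|1 - t| <= 1 by rewrite ger0_norm; lra.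
have := ler_piMr (normr_ge0 (D (k1 - i)%N c)) n1.
move: (t `^ (- theta)) Dc => P Dc h1 P1 h2.
have GM : Gam <= M * P.
  apply: (@le_trans _ _ M); last by rewrite ler_peMr.
  by rewrite /M lerDl mulr_ge0 ?(ltW l0)// addr_ge0 ?invr_ge0 ?(ltW th0).
by rewrite -mulrA mulrDl mul1r mulrA; lra.
Qed.

End one_variable_estimates.

(** * Comparison of the inner modulars *)

Section inner_norm.
Context {R : realType}.

(** The bounding power is at most 1, so raising it to an exponent [q >= 1] only lowers it. The
    result is uniform in [q]. *)
Lemma powR_two_sided_le (z t e e' q : R) : 0 <= z -> 0 < t -> 0 < e -> e <= e' -> 1 <= q ->
  z <= (if t < 1 then t `^ e' else t `^ (- e')) -> z `^ q <= two_sided_power e t.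
Proof.
move=> z0 t0 e0 ee q1; have ee0 : 0 < e' by lra.
have eq : e <= e' * q by rewrite (le_trans ee)// ler_peMr// ltW.
have [t1|t1] := ltP t 1 => zt; rewrite /two_sided_power le_min; apply/andP.
  suff h : z `^ q <= t `^ e.
    split=> //; apply: le_trans h _; apply: ger_powR; first by rewrite t0 ltW.
    lra.
  apply: (@le_trans _ _ ((t `^ e') `^ q)).
    by apply: ge0_ler_powR => //; rewrite ?nnegrE ?powR_ge0//; lra.
  by rewrite -powRrM; apply: ger_powR => //; rewrite t0 ltW.
suff h : z `^ q <= t `^ (- e).
  by split=> //; apply: le_trans h _; apply: ler_powR => //; lra.
apply: (@le_trans _ _ ((t `^ (- e')) `^ q)).
  by apply: ge0_ler_powR => //; rewrite ?nnegrE ?powR_ge0//; lra.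
by rewrite -powRrM mulNr; apply: ler_powR => //; lra.
Qed.

Lemma two_sided_powerE (e t : R) : 0 < t -> 0 < e ->
  two_sided_power e t = if t < 1 then t `^ e else t `^ (- e).
Proof.
move=> t0 e0; rewrite /two_sided_power; case: ltP => t1.
  by apply: min_l; apply: ger_powR; [rewrite t0 ltW|lra].
by apply: min_r; apply: ler_powR => //; lra.
Qed.

Lemma integral_dt_over_t_two_sided (e : R) : 0 < e ->
  (\int[dt_over_t]_(t in `]0%R, +oo[) (two_sided_power e t)%:E <= (2 / e)%:E)%E.
Proof.
move=> e0; rewrite ge0_integral_dt_over_t.
- exact: integral_two_sided_power.
- apply/measurable_EFinP; apply: (@measurable_funS _ _ _ _ setT) => //.
  exact: measurable_two_sided_power.
- by move=> t _; rewrite lee_fin two_sided_power_ge0.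
Qed.

Lemma lt_order_above (alpha : R) : 0 <= alpha -> alpha < (order_above alpha)%:R.
Proof. by move=> a0; rewrite order_aboveP. Qed.

Lemma order_above_pred (alpha : R) : 0 <= alpha ->
  (order_above alpha).-1%:R <= alpha.
Proof. by move=> a0; rewrite /order_above/= truncn_le. Qed.

Lemma inner_modular_le (q1 q2 : R -> R) (alpha1 alpha2 a : R) :
  let k1 := order_above alpha1 in let k2 := order_above alpha2 in
  0 < alpha2 -> alpha2 < alpha1 -> 0 < a -> 2 * a < alpha2 ->
  measurable_fun (`]0, +oo[ : set R) q1 ->
  {ae lebesgue_measure, forall t : R, 0 < t -> 1 <= q1 t} ->
  {ae lebesgue_measure, forall t : R, 0 < t -> 1 <= q2 t} ->
  {ae lebesgue_measure, forall t : R, 0 < t -> q2 t < q1 t} ->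
  exists2 C : R, 0 < C & forall (D : nat -> R -> R) (lam Gam : R),
  (forall j (t : R), 0 < t -> is_derive t (1 : R) (D j) (D j.+1 t)) ->
  0 < lam -> 0 <= Gam ->
  (forall j t, (j <= k1)%N -> 1 <= t -> `|D j t| <= t `^ (2 * a) * t^-1 ^+ j * Gam) ->
  (\int[dt_over_t]_(t in `]0%R, +oo[)
    ((`|t `^ (k1%:R - alpha1) * D k1 t| / lam) `^ q1 t)%:E <= 1)%E ->
  (\int[dt_over_t]_(t in `]0%R, +oo[)
    ((`|t `^ (k2%:R - alpha2) * D k2 t| / (C * (lam + Gam))) `^ q2 t)%:E <= 1)%E.
Proof.
move=> k1 k2 al2 al12 a0 a2 mq1 hq1 hq2 hq12.
have al1 : 0 < alpha1 by lra.
have k2a : alpha2 < k2%:R by apply: lt_order_above; exact: ltW.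
have k1a : alpha1 < k1%:R by apply: lt_order_above; exact: ltW.
have k1p : k1.-1%:R <= alpha1 by apply: order_above_pred; exact: ltW.
have k21 : (k2 <= k1)%N by rewrite -order_aboveP ?(ltW al2)//; lra.
(* Half of the gap: a loss of [t^(- theta)] in the derivative of order [k2] still leaves [t^theta]
   after multiplication by [t^(k2 - alpha2)]. *)
pose theta := (k2%:R - alpha2) / 2.
have th0 : 0 < theta by rewrite /theta; lra.
(* One decay rate for each regime: [t >= 1], then [t < 1] with [k2 = k1], then [t < 1] with
   [k2 < k1]. *)
pose e := Num.min (alpha2 - 2 * a) (Num.min (alpha1 - alpha2) theta).
have e0 : 0 < e by rewrite !lt_min th0; apply/and3P; split => //; lra.
have [ea [eal eth]] : [/\ e <= alpha2 - 2 * a & e <= alpha1 - alpha2 /\ e <= theta].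
  by rewrite /e !ge_min !lexx !orbT.
(* [C1] normalizes the pointwise bound [key], whose right-hand side has integral at most
   [1 + 2 / e = c]. As [q2 >= 1], a further division by [c] brings the modular down to 1. *)
pose C1 := 1 + k1%:R * (theta^-1 + 1); pose c := 1 + 2 / e.
have thV : 0 < theta^-1 by rewrite invr_gt0.
have C11 : 1 <= C1 by rewrite lerDl mulr_ge0//; lra.
have c1 : 1 <= c by rewrite lerDl divr_ge0// ltW.
have c0 : 0 < c by lra.
exists (c * C1); first by rewrite mulr_gt0//; lra.
move=> D lam Gam dD l0 G0 big mod1.
pose L := lam + Gam; have L0 : 0 < L by rewrite /L; lra.
have CL0 : 0 < C1 * L by rewrite mulr_gt0//; lra.
pose g t := `|t `^ (k1%:R - alpha1) * D k1 t|.
pose b t := `|t `^ (k2%:R - alpha2) * D k2 t|.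
have cD j (s : R) : 0 < s -> {for s, continuous (D j)}.
  by move=> s0; apply: differentiable_continuous; apply/derivable1_diffP; case: (dD j s s0).
have mg : measurable_fun (`]0, +oo[ : set R) g.
  apply: measurableT_comp => //; apply: measurable_funM.
    by apply: (@measurable_funS _ _ _ _ setT) => //; exact: measurable_powR.
  apply: open_continuous_measurable_fun; first exact: interval_open.
  by move=> s; rewrite inE/= in_itv/= andbT; exact: cD.
have mG : measurable_fun (`]0, +oo[ : set R) (fun t => ((g t / lam) `^ q1 t)%:E).
  by apply/measurable_EFinP; apply: measurable_fun_powR => //; exact: measurable_funM.
have g0 t : 0 <= g t by exact: normr_ge0.
have b0 t : 0 <= b t by exact: normr_ge0.
have gl0 t : 0 <= g t / lam by rewrite divr_ge0// ltW.
have key t : 0 < t -> 1 <= q1 t -> 1 <= q2 t -> q2 t < q1 t ->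
    (b t / (C1 * L)) `^ q2 t <= (g t / lam) `^ q1 t + two_sided_power e t.
  move=> t0 qt1 qt2 qt12.
  have zz0 : 0 <= b t / (C1 * L) by rewrite divr_ge0// ltW.
  have P0 := powR_ge0 (g t / lam) (q1 t).
  have [t1|t1] := leP 1 t.
    apply: (@le_trans _ _ (two_sided_power e t)); last by rewrite lerDr.
    apply: (@powR_two_sided_le _ _ _ (alpha2 - 2 * a)) => //.
    rewrite ltNge t1/= ler_pdivrMr// /b normrM (ger0_norm (powR_ge0 _ _)).
    apply: (@le_trans _ _ (t `^ (- (alpha2 - 2 * a)) * Gam)); last first.
      rewrite ler_wpM2l ?powR_ge0//; apply: (@le_trans _ _ L); last by rewrite ler_peMl// ltW.
      by rewrite /L; lra.
    apply: (le_trans (ler_wpM2l (powR_ge0 _ _) (big k2 t k21 t1))).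
    rewrite !mulrA ler_wpM2r// exprVn -(powR_invn _ (ltW t0)) -!powRD ?(gt_eqF t0) ?implybT//.
    by apply: ler_powR => //; lra.
  have t01 : 0 < t < 1 by rewrite t0 t1.
  have ts1 : two_sided_power e t <= 1.
    rewrite two_sided_powerE// t1 -(powRr0 t); apply: ger_powR; last exact: ltW.
    by rewrite t0 ltW.
  have ts0 := two_sided_power_ge0 e t.
  move: k21; rewrite leq_eqVlt => /orP[/eqP k12|k21].
    have tp : 0 <= t `^ (alpha1 - alpha2) by exact: powR_ge0.
    have bE : b t = t `^ (alpha1 - alpha2) * g t.
      rewrite /b /g -k12 !normrM !(ger0_norm (powR_ge0 _ _)) mulrA.
      rewrite -powRD; last by rewrite (gt_eqF t0) implybT.
      by congr (_ `^ _ * _); lra.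
    apply: (@le_trans _ _ ((t `^ (alpha1 - alpha2) * (g t / lam)) `^ q2 t)).
      apply: ge0_ler_powR; rewrite ?nnegrE//; first lra.
        by rewrite mulr_ge0.
      rewrite bE -mulrA ler_wpM2l// ler_wpM2l// lef_pV2 ?posrE//.
      by apply: (@le_trans _ _ L); [rewrite /L; lra|rewrite ler_peMl// ltW].
    rewrite powRM//.
    (* The factor [t^(alpha1 - alpha2)] makes the constant 1 integrable; on the other term it is
       simply bounded by 1. *)
    apply: (@le_trans _ _ (two_sided_power e t * (1 + (g t / lam) `^ q1 t))).
      apply: ler_pM; rewrite ?powR_ge0//.
        by apply: (@powR_two_sided_le _ _ _ (alpha1 - alpha2)) => //; rewrite t1.
      by apply: powR_le1D => //; lra.
    by rewrite mulrDr mulr1 addrC lerD2r ler_piMl.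
  apply: (@le_trans _ _ (two_sided_power e t)); last by rewrite lerDr.
  apply: (@powR_two_sided_le _ _ _ theta) => //.
  rewrite t1 ler_pdivrMr//.
  (* [lower_derivatives_le] is indexed by the order just below the controlled one, here [k1.-1],
     which is at most [alpha1]. *)
  have k1E : k1 = k1.-1.+1 by rewrite prednK// (leq_ltn_trans _ k21).
  have D1 j : (j <= k1.-1)%N -> `|D j 1| <= Gam.
    move=> jk; have := big j 1 (leq_trans jk (leq_pred _)) (lexx _).
    by rewrite powR1 invr1 expr1n !mul1r.
  rewrite k1E in mod1.
  have k2p : (k2 <= k1.-1)%N by rewrite -ltnS -k1E.
  have := lower_derivatives_le dD l0 G0 th0 k1p mq1 hq1 D1 mod1 k2p t01.
  rewrite -k1E => Dk.
  rewrite /b normrM (ger0_norm (powR_ge0 _ _)).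
  apply: (le_trans (ler_wpM2l (powR_ge0 _ _) Dk)).
  rewrite mulrCA -powRD; last by rewrite (gt_eqF t0) implybT.
  rewrite (_ : k2%:R - alpha2 - theta = theta); last by rewrite /theta; lra.
  rewrite mulrC ler_wpM2l ?powR_ge0//.
  apply: (@le_trans _ _ (k1%:R * ((theta^-1 + 1) * L))).
    apply: ler_pM => //.
    - by rewrite addr_ge0// mulr_ge0//; lra.
    - by rewrite ler_nat leq_subr.
    - have hG : Gam <= (theta^-1 + 1) * Gam by rewrite ler_peMl// lerDr ltW.
      by rewrite /L; lra.
  by rewrite mulrA ler_wpM2r ?(ltW L0)// /C1 lerDr.
have ae_bound : {ae dt_over_t, forall t : R, `]0, +oo[%classic t ->
    (((b t / (c * C1 * L)) `^ q2 t)%:E <=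
     (c^-1)%:E * ((g t / lam) `^ q1 t)%:E + (c^-1)%:E * (two_sided_power e t)%:E)%E}.
  apply: ae_dt_over_t; apply: ae_impl (ae_and (ae_and hq1 hq2) hq12) => t [[h1 h2] h12].
  rewrite /= in_itv/= andbT => t0; rewrite -!EFinM -EFinD lee_fin -mulrDr.
  rewrite (_ : b t / (c * C1 * L) = c^-1 * (b t / (C1 * L))); last first.
    by rewrite -(mulrA c) invfM mulrCA.
  apply: (le_trans (ge1r_powRZ _ _ (h2 t0))).
  - by rewrite invr_gt0 c0 invf_le1.
  - by rewrite divr_ge0// ltW.
  by rewrite ler_wpM2l ?invr_ge0 ?(ltW c0)//; apply: key => //; auto.
have cV0 : (0 <= (c^-1)%:E :> \bar R)%E by rewrite lee_fin invr_ge0 ltW.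
have mts : measurable_fun (`]0, +oo[ : set R) (fun t => (two_sided_power e t)%:E).
  apply/measurable_EFinP; apply: (@measurable_funS _ _ _ _ setT) => //.
  exact: measurable_two_sided_power.
apply: (@le_trans _ _ (\int[dt_over_t]_(t in `]0%R, +oo[)
    ((c^-1)%:E * ((g t / lam) `^ q1 t)%:E) +
  \int[dt_over_t]_(t in `]0%R, +oo[) ((c^-1)%:E * (two_sided_power e t)%:E))%E).
  apply: ae_le_integral_add => //.
  - by move=> t _; rewrite lee_fin powR_ge0.
  - by move=> t _; rewrite mule_ge0// lee_fin powR_ge0.
  - by move=> t _; rewrite mule_ge0// lee_fin two_sided_power_ge0.
  - exact: measurable_funeM.
rewrite !ge0_integralZl//; last 2 first.
- by move=> t _; rewrite lee_fin two_sided_power_ge0.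
- by move=> t _; rewrite lee_fin powR_ge0.
apply: (@le_trans _ _ ((c^-1)%:E * 1 + (c^-1)%:E * (2 / e)%:E)%E).
  apply: leeD; apply: lee_wpmul2l => //; exact: integral_dt_over_t_two_sided.
by rewrite mule1 -EFinM -EFinD lee_fin -[X in X + _]mulr1 -mulrDr mulVf// gt_eqF.
Qed.

End inner_norm.

Lemma P_0_infty_ge1 {R : realType} (q : R -> R) : P_0_infty q ->
  {ae lebesgue_measure, forall t : R, 0 < t -> 1 <= q t}.
Proof.
move=> [_ _ /ess_infP [N [mN N0 qN]] _ _].
exists (N `&` `]0, +oo[); split.
- by apply: measurableI => //; exact: measurable_itv.
(* By definition, [lebesgue_pos N] is the Lebesgue measure of this intersection. *)
- exact: N0.
- move=> t /= /not_implyP[t0 qt]; split; last by rewrite /= in_itv/= andbT.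
  by apply: qN => /=; rewrite lee_fin.
Qed.

(** * Luxemburg norms and the outer norm *)

Lemma vLnorm_lty_modular d (T : measurableType d) {R : realType}
    (mu : {measure set T -> \bar R}) (D : set T) (p : T -> R) (f : T -> \bar R) :
  (vLnorm mu D p f < +oo)%E ->
  exists2 l : R, 0 < l & (\int[mu]_(x in D) `|f x * (l^-1)%:E| `^ p x <= 1)%E.
Proof. by move=> /ereal_inf_lt[_ /= [l [l0 fl] <-] _]; exists l. Qed.

Lemma vLnorm_le_modular d (T : measurableType d) {R : realType}
    (mu : {measure set T -> \bar R}) (D : set T) (p : T -> R) (f : T -> \bar R) (l : R) :
  0 < l -> (\int[mu]_(x in D) `|f x * (l^-1)%:E| `^ p x <= 1)%E ->
  (vLnorm mu D p f <= l%:E)%E.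
Proof. by move=> l0 fl; apply: ereal_inf_lbound; exists l. Qed.

Lemma vLnorm_ge0 d (T : measurableType d) {R : realType}
    (mu : {measure set T -> \bar R}) (D : set T) (p : T -> R) (f : T -> \bar R) :
  (0 <= vLnorm mu D p f)%E.
Proof. by apply: le_ereal_inf_tmp => _ [l [l0 _] <-]; rewrite lee_fin ltW. Qed.

Section outer_norm.
Context d (T : measurableType d) {R : realType}.
Variables (mu : {measure set T -> \bar R}) (p : T -> R).
Hypothesis p1 : forall x, 1 <= p x.

Lemma measurable_fun_poweR (g : T -> \bar R) : (forall x, 0 <= g x)%E ->
  measurable_fun setT g -> measurable_fun setT p ->
  measurable_fun setT (fun x => g x `^ p x)%E.
Proof.
move=> g0 mg mp.
have -> : (fun x => g x `^ p x)%E =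
    (fun x => if g x == +oo%E then +oo%E else (fine (g x) `^ p x)%:E).
  apply/funext => x; have := g0 x; have := p1 x.
  case: (g x) => [r|px _|//] => [//|]; rewrite ?poweR_EFin//.
  by rewrite eqxx poweRyr// gt_eqF//; lra.
apply: measurable_fun_ifT => //.
- exact: measurable_fun_eqe.
- apply/measurable_EFinP; apply: measurable_fun_powR => //.
  exact: measurableT_comp.
Qed.

(** A maximum in place of a sum avoids a factor [2^q], which would vary with the exponent. *)
Let outer_pointwise (z n g : \bar R) (b q : R) : 0 < b <= 1 -> 1 <= q ->
  (0 <= z -> 0 <= n -> 0 <= g -> z <= b%:E * maxe n g ->
   z `^ q <= b%:E * n `^ q + b%:E * g `^ q)%E.
Proof.
move=> /andP[b0 b1] q1; have q0 : q != 0 by rewrite gt_eqF//; lra.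
have yq : (b%:E * +oo `^ q = +oo)%E by rewrite poweRyr// gt0_muley// lte_fin.
have qq (r : \bar R) : (0 <= b%:E * r `^ q)%E by rewrite mule_ge0 ?poweR_ge0// lee_fin ltW.
case: n => [n|_ _ _ _|//]; last first.
  by rewrite yq addye ?leey// gt_eqF// (lt_le_trans _ (qq _)).
case: g => [g|_ _ _ _|//]; last first.
  by rewrite yq addey ?leey// gt_eqF// (lt_le_trans _ (qq _)).
rewrite -EFin_max -EFinM; case: z => [z| |//]; last by rewrite leye_eq.
rewrite !poweR_EFin -!EFinM -EFinD !lee_fin => z0 n0 g0 zw.
have m0 : 0 <= Num.max n g by rewrite le_max n0.
apply: (@le_trans _ _ ((b * Num.max n g) `^ q)).
  by apply: ge0_ler_powR => //; rewrite ?nnegrE ?mulr_ge0 ?(ltW b0)//; lra.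
apply: (le_trans (ge1r_powRZ _ m0 q1)); first by rewrite b0.
rewrite -mulrDr ler_wpM2l ?(ltW b0)//.
by rewrite maxEle; case: ifP => _; rewrite ?lerDl ?lerDr powR_ge0.
Qed.

(** Only [G] and [p] are measurable here; [N1] and [N2] will be inner norms. The control of [G] is
    by a modular bound [B] that may exceed 1. *)
Lemma vLnorm_lty_dominated (N2 N1 G : T -> \bar R) (C l B : R) :
  0 < C -> 0 < l -> 0 < B ->
  (forall x, 0 <= N2 x)%E -> (forall x, 0 <= N1 x)%E -> (forall x, 0 <= G x)%E ->
  measurable_fun setT G -> measurable_fun setT p ->
  (forall x, N2 x <= C%:E * (N1 x + G x))%E ->
  (vLnorm mu setT p N1 < +oo)%E ->
  (\int[mu]_x (G x * (l^-1)%:E) `^ p x <= B%:E)%E ->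
  (vLnorm mu setT p N2 < +oo)%E.
Proof.
move=> C0 l0 B0 N20 N10 G0 mG mp N2le /vLnorm_lty_modular[l1 l10 N1l] Gl.
(* The two modulars add up to at most [b * 1 + b * B = 1]; since
   [C * (N1 + G) <= C * (l1 + l) * max(n, g)], this dictates [L]. *)
pose b := (1 + B)^-1; have b0 : 0 < b by rewrite invr_gt0; lra.
have b1 : b <= 1 by rewrite invf_le1; lra.
pose L := C * (l1 + l) / b.
have L0 : 0 < L by rewrite divr_gt0// mulr_gt0//; lra.
apply: (@le_lt_trans _ _ L%:E); last exact: ltry.
apply: vLnorm_le_modular => //.
pose n x := `|N1 x * (l1^-1)%:E|%E; pose g x := (G x * (l^-1)%:E)%E.
have g0 x : (0 <= g x)%E by rewrite mule_ge0// lee_fin invr_ge0 ltW.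
have n0 x : (0 <= n x)%E by exact: abse_ge0.
have mgp : measurable_fun setT (fun x => g x `^ p x)%E.
  by apply: measurable_fun_poweR => //; exact: emeasurable_funM.
apply: (@le_trans _ _ (\int[mu]_x (b%:E * n x `^ p x) + \int[mu]_x (b%:E * g x `^ p x))%E).
  apply: ae_le_integral_add => //.
  - by move=> x _; exact: poweR_ge0.
  - by move=> x _; rewrite mule_ge0 ?poweR_ge0// lee_fin ltW.
  - by move=> x _; rewrite mule_ge0 ?poweR_ge0// lee_fin ltW.
  - exact: measurable_funeM.
  apply: aeW => x _; apply: outer_pointwise => //; first by rewrite b0.
  rewrite gee0_abs; last by rewrite mule_ge0// lee_fin invr_ge0 ltW.
  have Lle : (`|N1 x| <= l1%:E * n x)%E.
    rewrite /n abseM gee0_abs// gee0_abs ?lee_fin ?invr_ge0 ?(ltW l10)//.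
    by rewrite muleCA -EFinM mulfV ?gt_eqF// mule1.
  have Gle : (G x <= l%:E * g x)%E.
    by rewrite /g muleCA -EFinM mulfV ?gt_eqF// mule1.
  have n1 : (n x <= maxe (n x) (g x))%E by rewrite le_max lexx.
  have g1 : (g x <= maxe (n x) (g x))%E by rewrite le_max lexx orbT.
  have m0 : (0 <= maxe (n x) (g x))%E by rewrite le_max n0.
  rewrite lee_pdivrMr// muleAC -EFinM.
  have -> : (b * L = C * (l1 + l))%R by rewrite /L mulrCA divff ?mulr1// gt_eqF.
  apply: (le_trans (N2le x)); rewrite EFinM -muleA lee_wpmul2l ?lee_fin ?(ltW C0)//.
  rewrite EFinD ge0_muleDl ?lee_fin ?(ltW l0) ?(ltW l10)//.
  rewrite gee0_abs// in Lle.
  by apply: leeD; [apply: (le_trans Lle)|apply: (le_trans Gle)]; rewrite lee_wpmul2l// lee_fin ltW.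
apply: (@le_trans _ _ (b%:E * 1 + b%:E * B%:E)%E).
  apply: leeD.
    apply: (le_trans (le_integralZl_nonmeasurable _ b0 _)); first by move=> x; exact: poweR_ge0.
    by rewrite lee_wpmul2l// lee_fin ltW.
  rewrite ge0_integralZl//; last 2 first.
  - by move=> x _; exact: poweR_ge0.
  - by rewrite lee_fin ltW.
  by rewrite lee_wpmul2l// lee_fin ltW.
by rewrite mule1 -EFinM -EFinD lee_fin -[X in X + _]mulr1 -mulrDr /b mulVf//; lra.
Qed.

End outer_norm.

(** * Assembling the inner and outer estimates *)

Lemma poisson_mean_large_time_uniform {R : realType} (d k : nat) (a : R) :
  0 < a -> 2 * a <= 1 -> exists2 C : R, 0 < C &
  forall (x : d.-tuple R) (f : d.-tuple R -> R), measurable_fun setT f ->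
  (\int[@gauss_measure R d]_y `|(f y)%:E| < +oo)%E ->
  forall j t, (j <= k)%N -> 1 <= t -> ((`|poisson_mean x f j t|)%:E <=
    (C * (t `^ (2 * a) * t^-1 ^+ j))%:E *
    \int[@gauss_measure R d]_y (averaged_mehler a (x, y) * (`|f y|)%:E))%E.
Proof.
move=> a0 a1; elim: k => [|k [C C0 IH]].
  have [C C0 HC] := poisson_mean_large_time d 0 a0 a1.
  by exists C => // x f mf intf [|//] t _; exact: HC.
have [C' C'0 HC'] := poisson_mean_large_time d k.+1 a0 a1.
exists (C + C') => [|x f mf intf j t jk t1]; first exact: addr_gt0.
have G0 : (0 <= \int[@gauss_measure R d]_y (averaged_mehler a (x, y) * (`|f y|)%:E))%E.
  by apply: integral_ge0 => y _; rewrite mule_ge0 ?averaged_mehler_ge0// lee_fin.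
have w0 : 0 <= t `^ (2 * a) * t^-1 ^+ j.
  by apply: mulr_ge0; [exact: powR_ge0|rewrite exprn_ge0// invr_ge0; lra].
have [jk'|jk'] := leqP j k.
  apply: (le_trans (IH x f mf intf j t jk' t1)).
  by rewrite lee_wpmul2r// lee_fin ler_wpM2r//; lra.
have -> : j = k.+1 by apply/eqP; rewrite eqn_leq jk jk'.
have {}jk' : j = k.+1 by apply/eqP; rewrite eqn_leq jk jk'.
rewrite jk' in w0; apply: (le_trans (HC' x f mf intf t t1)).
by rewrite lee_wpmul2r// lee_fin ler_wpM2r//; lra.
Qed.

Lemma vLnorm_dt_over_tE {R : realType} (q f g : R -> R) (l : R) : 0 < l ->
  (forall t, 0 < t -> f t = g t) ->
  (\int[dt_over_t]_(t in `]0%R, +oo[) (`|(f t)%:E * (l^-1)%:E| `^ q t) =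
   \int[dt_over_t]_(t in `]0%R, +oo[) ((`|g t| / l) `^ q t)%:E)%E.
Proof.
move=> l0 fg; apply: eq_integral => t; rewrite inE/= in_itv/= andbT => t0.
by rewrite fg// normrM [`|l^-1|]gtr0_norm ?invr_gt0//.
Qed.

Lemma TL_inner_le {R : realType} (d : nat) (q1 q2 : R -> R) (alpha1 alpha2 a : R) :
  0 < alpha2 -> alpha2 < alpha1 -> 0 < a -> 2 * a < alpha2 -> 2 * a <= 1 ->
  P_0_infty q1 -> P_0_infty q2 ->
  {ae lebesgue_measure, forall t : R, 0 < t -> q2 t < q1 t} ->
  exists2 C : R, 0 < C & forall (f : d.-tuple R -> R) (x : d.-tuple R),
  measurable_fun setT f -> (\int[@gauss_measure R d]_y `|(f y)%:E| < +oo)%E ->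
  (TL_inner alpha2 q2 f x <= C%:E * (TL_inner alpha1 q1 f x +
     \int[@gauss_measure R d]_y (averaged_mehler a (x, y) * (`|f y|)%:E)))%E.
Proof.
move=> al2 al12 a0 aal a1 hq1 hq2 q21.
have mq1 : measurable_fun (`]0, +oo[ : set R) q1 by case: hq1.
have [C1 C10 HC1] := inner_modular_le al2 al12 a0 aal mq1
  (P_0_infty_ge1 hq1) (P_0_infty_ge1 hq2) q21.
have [C2 C20 HC2] := poisson_mean_large_time_uniform d (order_above alpha1) a0 a1.
pose s : R := (Num.sqrt pi)^-1.
have s0 : 0 < s by rewrite invr_gt0 sqrtr_gt0 pi_gt0.
pose c := s * C2; have c0 : 0 < c by rewrite mulr_gt0.
have C0 : 0 < C1 * (1 + c) by rewrite mulr_gt0//; lra.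
exists (C1 * (1 + c)) => // f x mf intf.
set G := (\int[_]_y _)%E.
have G0 : (0 <= G)%E.
  by apply: integral_ge0 => y _; rewrite mule_ge0 ?averaged_mehler_ge0// lee_fin.
have N10 : (0 <= TL_inner alpha1 q1 f x)%E by exact: vLnorm_ge0.
have [->|Gfin] := eqVneq G +oo%E.
  by rewrite addey ?gt0_muley ?leey ?lte_fin// gt_eqF// (lt_le_trans _ N10)// ltNy0.
have {Gfin} /fineK Gg : G \is a fin_num by rewrite ge0_fin_numE// lt_neqAle Gfin leey.
set g := fine G in Gg; have g0 : 0 <= g by exact: fine_ge0.
suff H : (TL_inner alpha2 q2 f x <= C1%:E * (TL_inner alpha1 q1 f x + (c * g)%:E))%E.
  apply: (le_trans H); rewrite [(C1 * _)%:E]EFinM -muleA lee_wpmul2l ?lee_fin ?(ltW C10)//.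
  rewrite -Gg EFinD ge0_muleDl ?lee_fin ?(ltW c0)// mul1e leeD//.
    by rewrite leeDl// lee_fin.
  by rewrite EFinM lee_wpmul2l ?lee_fin ?(ltW c0)// leeDr.
(* The first norm is an infimum: with the affine map moved to the left, it suffices to prove the
   bound for each admissible [lam]. *)
rewrite -lee_pdivrMl// -leeBlDr//; apply: le_ereal_inf_tmp => _ [lam [lam0 Hlam] <-].
rewrite leeBlDr// -EFinD lee_pdivrMl// -EFinM.
apply: vLnorm_le_modular; first by rewrite mulr_gt0//; have := mulr_ge0 (ltW c0) g0; lra.
pose D j t := s * poisson_mean x f j t.
have E k alpha t : 0 < t ->
    t `^ (k%:R - alpha) * derive1n k (fun s => poisson_hermite s f x) t =
    t `^ (k%:R - alpha) * D k t.
  by move=> t0; rewrite (derive1n_poisson_hermite x mf intf).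
rewrite (vLnorm_dt_over_tE _ _ (E _ _)); last first.
  by rewrite mulr_gt0//; have := mulr_ge0 (ltW c0) g0; lra.
apply: (HC1 D lam (c * g)) => [||||].
- move=> j t t0; exact: (is_deriveZ s (is_derive_poisson_mean x mf intf j t0)).
- exact: lam0.
- by rewrite mulr_ge0// ltW.
- move=> j t jk t1; have := HC2 x f mf intf j t jk t1; rewrite -/G -Gg -EFinM lee_fin => H.
  rewrite /D normrM gtr0_norm//.
  apply: (le_trans (ler_wpM2l (ltW s0) H)).
  by rewrite /c le_eqVlt; apply/orP; left; apply/eqP; ring.
- by move: Hlam; rewrite (vLnorm_dt_over_tE _ lam0 (E _ _)).
Qed.

Theorem proposition2p2 (R : realType) (d : nat)
    (p : d.-tuple R -> R) (q1 q2 : R -> R) (alpha1 alpha2 : R)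
    (hp : P_gauss_infty p) (hpLH : LH0 p)
    (hq1 : P_0_infty q1) (hq2 : P_0_infty q2)
    (halpha2 : 0 < alpha2) (halpha12 : alpha2 < alpha1)
    (hq12 : {ae lebesgue_measure, forall t : R, 0 < t -> q2 t < q1 t}) :
  triebel_lizorkin p q1 alpha1 `<=` triebel_lizorkin p q2 alpha2.
Proof.
move=> f [[mf fp] fTL]; split; first exact: (conj mf fp).
have [mp p1 _] := hp.
have [l l0 fl] := vLnorm_lty_modular fp.
have {}fl : (\int[@gauss_measure R d]_x ((`|f x| / l) `^ p x)%:E <= 1)%E.
  apply: le_trans fl; rewrite le_eqVlt; apply/orP; left; apply/eqP.
  apply: eq_integral => x _.
  by rewrite /= normrM [`|l^-1|]gtr0_norm ?invr_gt0.
have mfl : measurable_fun setT (fun x => `|f x| / l).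
  by apply: measurable_funM => //; exact: measurableT_comp.
have fl0 x : 0 <= `|f x| / l by rewrite divr_ge0// ltW.
(* The Gaussian measure is finite, so [z <= 1 + z^p] puts [f] in [L^1], as differentiation under the
   integral requires. *)
have intf : (\int[@gauss_measure R d]_y `|(f y)%:E| < +oo)%E.
  apply: (@le_lt_trans _ _ (\int[@gauss_measure R d]_y (l%:E * (1 + ((`|f y| / l) `^ p y)%:E)))%E).
    apply: ge0_le_integral_nonmeasurable => // y _.
    rewrite abse_EFin -EFinD -EFinM lee_fin -ler_pdivrMl// mulrC.
    exact: le1D_powR.
  rewrite ge0_integralZl//; last 3 first.
  - by apply: emeasurable_funD => //; apply/measurable_EFinP; exact: measurable_fun_powR.
  - by move=> y _; rewrite adde_ge0// lee_fin powR_ge0.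
  - by rewrite lee_fin ltW.
  rewrite lte_mul_pinfty ?lee_fin ?(ltW l0)// ge0_integralD//; last 2 first.
  - by move=> y _; rewrite lee_fin powR_ge0.
  - by apply/measurable_EFinP; exact: measurable_fun_powR.
  rewrite integral_cst// mul1e (_ : _ setT = 1%E); last exact: (@probability_setT _ _ _ (@gauss_measure R d)).
  by rewrite lte_add_pinfty ?ltry// (le_lt_trans fl)// ltry.
(* Both [2 a <= 1], for the integrability of the weight, and [2 a < alpha2], for decay at large [t],
   must hold. *)
pose a := Num.min 2^-1 (alpha2 / 4).
have a0 : 0 < a by rewrite lt_min; apply/andP; split; lra.
have [a12 aal] : a <= 2^-1 /\ a <= alpha2 / 4 by rewrite /a !ge_min !lexx orbT.
have a1 : 2 * a <= 1 by lra.
have aal2 : 2 * a < alpha2 by lra.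
have [C C0 HC] := TL_inner_le d halpha2 halpha12 a0 aal2 a1 hq1 hq2 hq12.
have [D [B [D0 B0 HDB]]] := averaged_mehler_modular a0 a1 hp.
have Dl0 : 0 < D * l by exact: mulr_gt0.
apply: (vLnorm_lty_dominated p1 C0 Dl0 B0 _ _ _ _ mp (fun x => HC f x mf intf)) => //.
- by move=> x; exact: vLnorm_ge0.
- by move=> x; exact: vLnorm_ge0.
- by move=> x; apply: integral_ge0 => y _; rewrite mule_ge0 ?averaged_mehler_ge0// lee_fin.
- apply: (measurable_fun_fubini_tonelli_F (m2 := @gauss_measure R d)
    (fun z => averaged_mehler a z * (`|f z.2|)%:E)%E).
    apply: emeasurable_funM; first exact: measurable_averaged_mehler.
    apply/measurable_EFinP; apply: measurableT_comp => //.
    exact: (measurableT_comp mf measurable_snd).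
  by move=> z; rewrite mule_ge0 ?averaged_mehler_ge0// lee_fin.
(* [HDB] concerns [|f| / l]; linearity of the average moves [l] into the scale [D * l]. *)
apply: le_trans (HDB _ mfl fl0 fl); rewrite le_eqVlt; apply/orP; left; apply/eqP.
apply: eq_integral => x _; congr (_ `^ _)%E.
rewrite [RHS]muleC invfM EFinM muleCA; congr (_ * _)%E.
rewrite muleC -ge0_integralZl//; last 3 first.
- apply: emeasurable_funM.
    exact: (measurableT_comp (measurable_averaged_mehler a) (measurable_pair1 _)).
  by apply/measurable_EFinP; exact: measurableT_comp.
- by move=> y _; rewrite mule_ge0 ?averaged_mehler_ge0// lee_fin.
- by rewrite lee_fin invr_ge0 ltW.
by apply: eq_integral => y _; rewrite muleCA -EFinM [(l^-1 * _)%R]mulrC.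
Qed.
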